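(* Let $\mathcal A,\mathcal B$ be unital Banach algebras and let $\phi\colon\mathcal A\to\mathcal B$ be a unital continuous homomorphism with dense range. If $\phi$ is relatively spectral (i.e. there is a dense subalgebra $X$ of $\mathcal A$ such that $\mathrm{sp}_{\mathcal B}(\phi(x))=\mathrm{sp}_{\mathcal A}(x)$ for all $x\in X$), then the induced group homomorphisms $\phi_*\colon K_i(\mathcal A)\to K_i(\mathcal B)$ are injective for $i=0,1$.
   Context: $\mathrm{sp}_{\mathcal A}(a)$ denotes the spectrum of $a$ in $\mathcal A$. For a unital Banach algebra $\mathcal A$, $GL(\mathcal A)$ is the group of invertible elements and $GL_0(\mathcal A)$ is the connected component of $1$ in $GL(\mathcal A)$. $\mathrm M_n(\mathcal A)$ is the algebra of $n\times n$ matrices over $\mathcal A$, normed by $\|(a_{ij})\|=\sum_{i,j}\|a_{ij}\|$; $GL_n(\mathcal A)=GL(\mathrm M_n(\mathcal A))$ and $GL_n^0(\mathcal A)=GL_0(\mathrm M_n(\mathcal A))$. $K_1(\mathcal A)$ is the direct limit (union) over $n\ge 1$ of the groups $GL_n(\mathcal A)/GL_n^0(\mathcal A)$ along the maps $[x]\mapsto[\mathrm{diag}(x,1)]$. $K_0(\mathcal A)$ is defined as $K_1((S\mathcal A)^+)$, where $(S\mathcal A)^+$ is the unital Banach algebra (sup norm, pointwise operations) of continuous $f\colon[0,1]\to\mathcal A$ such that $f(0)=f(1)$ is a scalar multiple of the unit $1$. The map $\phi_*$ on $K_1$ is induced by applying $\phi$ entrywise to matrices, $\phi_n((a_{ij}))=(\phi(a_{ij}))$;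 the map $\phi_*$ on $K_0$ is the map on $K_1((S\mathcal A)^+)\to K_1((S\mathcal B)^+)$ induced by the unital homomorphism $f\mapsto\phi\circ f$. *)

(* Defs.v *)
From HB Require Import structures.
From mathcomp Require Import all_boot all_order all_algebra.
From mathcomp Require Import generic_quotient complex ring.
From mathcomp Require Import all_classical all_reals all_analysis.
Import numFieldNormedType.Exports.
Set Implicit Arguments.
Unset Strict Implicit.
Unset Printing Implicit Defensive.
Import Order.TTheory GRing.Theory Num.Theory.

Local Open Scope classical_set_scope.
Local Open Scope ring_scope.

Section GroupMorphism.
Local Open Scope group_scope.
Variables (G H : groupType) (f : {multiplicative G -> H}).

Lemma group_morph1 : f 1 = 1.
Proof. by apply: (mulgI (f 1)); rewrite -gmulfM !mulg1. Qed.

Lemma group_morphV x : f x^-1 = (f x)^-1.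
Proof. by apply/esym/mulg1_eq; rewrite -gmulfM mulgV group_morph1. Qed.

End GroupMorphism.

Section QuotientGroup.
Local Open Scope group_scope.
Local Open Scope quotient_scope.

Record normal_subgroup (G : groupType) := NormalSubgroup {
  nsg_set :> G -> Prop;
  nsg1 : nsg_set 1;
  nsgM : forall x y, nsg_set x -> nsg_set y -> nsg_set (x * y);
  nsgV : forall x, nsg_set x -> nsg_set x^-1;
  nsgJ : forall x y, nsg_set x -> nsg_set (x ^ y)
}.

Variables (G : groupType) (N : normal_subgroup G).

Definition coset_rel : rel G := fun x y => `[< N (x^-1 * y) >].

Let coset_refl : reflexive coset_rel.
Proof. by move=> x; apply/asboolP; rewrite mulVg; exact: nsg1. Qed.

Let coset_sym : symmetric coset_rel.
Proof.
suff H x y : coset_rel x y -> coset_rel y x by move=> x y; apply/idP/idP; exact: H.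
by move=> /asboolP /nsgV; rewrite invgM invgK => ?; apply/asboolP.
Qed.

Let coset_trans : transitive coset_rel.
Proof.
move=> y x z /asboolP xy /asboolP yz; apply/asboolP.
by move: (nsgM xy yz); rewrite -mulgA mulVKg.
Qed.

Canonical coset_equiv := EquivRel coset_rel coset_refl coset_sym coset_trans.

Definition quotient_group : Type := {eq_quot coset_equiv}.
HB.instance Definition _ := Choice.on quotient_group.
HB.instance Definition _ := EqQuotient.on quotient_group.

Definition quotient_proj (x : G) : quotient_group := \pi_quotient_group x.

Lemma quotient_projP (x y : G) :
  quotient_proj x = quotient_proj y <-> N (x^-1 * y).
Proof.
by split=> [/eqquotP/asboolP//|H]; apply/eqquotP; exact/asboolP.
Qed.

Lemma quotient_proj_surj (a : quotient_group) : exists x, a = quotient_proj x.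
Proof. by exists (repr a); rewrite /quotient_proj reprK. Qed.

Lemma coset_reprP x : N ((repr (quotient_proj x))^-1 * x).
Proof. by apply/quotient_projP; rewrite /quotient_proj reprK. Qed.

Definition coset_one : quotient_group := quotient_proj 1.
Definition coset_inv (a : quotient_group) : quotient_group :=
  quotient_proj (repr a)^-1.
Definition coset_mul (a b : quotient_group) : quotient_group :=
  quotient_proj (repr a * repr b).

Lemma coset_mulE x y :
  coset_mul (quotient_proj x) (quotient_proj y) = quotient_proj (x * y).
Proof.
apply/quotient_projP; have := coset_reprP x; have := coset_reprP y.
set a := repr _; set b := repr _ => ay bx.
have -> : (b * a)^-1 * (x * y) = ((b^-1 * x) ^ a) * (a^-1 * y).
  by rewrite conjgE invgM -!mulgA mulVKg.
by apply: nsgM => //; exact: nsgJ.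
Qed.

Lemma coset_invE x : coset_inv (quotient_proj x) = quotient_proj x^-1.
Proof.
apply/quotient_projP; rewrite invgK; have := coset_reprP x.
set a := repr _ => ax.
have -> : a * x^-1 = ((a^-1 * x) ^ a^-1)^-1.
  by rewrite conjgE invgK -!mulgA mulVKg invgM invgK.
by apply: nsgV; exact: nsgJ.
Qed.

Let coset_mulA : associative coset_mul.
Proof.
move=> a b c; have [x ->] := quotient_proj_surj a.
have [y ->] := quotient_proj_surj b; have [z ->] := quotient_proj_surj c.
by rewrite !coset_mulE mulgA.
Qed.

Let coset_mul1g : left_id coset_one coset_mul.
Proof. by move=> a; have [x ->] := quotient_proj_surj a; rewrite coset_mulE mul1g. Qed.

Let coset_mulg1 : right_id coset_one coset_mul.
Proof. by move=> a; have [x ->] := quotient_proj_surj a; rewrite coset_mulE mulg1. Qed.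

Let coset_mulVg : left_inverse coset_one coset_inv coset_mul.
Proof.
by move=> a; have [x ->] := quotient_proj_surj a; rewrite coset_invE coset_mulE mulVg.
Qed.

Let coset_mulgV : right_inverse coset_one coset_inv coset_mul.
Proof.
by move=> a; have [x ->] := quotient_proj_surj a; rewrite coset_invE coset_mulE mulgV.
Qed.

HB.instance Definition _ := isGroup.Build quotient_group
  coset_mulA coset_mul1g coset_mulg1 coset_mulVg coset_mulgV.

Let quotient_projM : {morph quotient_proj : x y / x * y}.
Proof. by move=> x y; rewrite -coset_mulE. Qed.

HB.instance Definition _ :=
  isMultiplicative.Build G quotient_group quotient_proj quotient_projM.

Lemma quotient_proj1P x : quotient_proj x = 1 <-> N x.
Proof.
rewrite -[1]/(quotient_proj 1) quotient_projP mulg1.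
by split => /nsgV; rewrite ?invgK.
Qed.

End QuotientGroup.

Section QuotientMap.
Local Open Scope group_scope.
Variables (G H : groupType) (N : normal_subgroup G) (M : normal_subgroup H).
Variable f : {multiplicative G -> H}.

Definition quotient_map (fNM : forall x, N x -> M (f x))
  (a : quotient_group N) : quotient_group M := quotient_proj M (f (repr a)).

Hypothesis fNM : forall x, N x -> M (f x).

Lemma quotient_mapE x :
  quotient_map fNM (quotient_proj N x) = quotient_proj M (f x).
Proof.
apply/quotient_projP; rewrite -group_morphV -gmulfM; apply: fNM; exact: coset_reprP.
Qed.

Let quotient_mapM : {morph quotient_map fNM : x y / x * y}.
Proof.
move=> a b; have [x ->] := quotient_proj_surj a.
have [y ->] := quotient_proj_surj b.
by rewrite -gmulfM !quotient_mapE gmulfM; exact: gmulfM.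
Qed.

HB.instance Definition _ := isMultiplicative.Build _ _ (quotient_map fNM)
  quotient_mapM.

End QuotientMap.

Section DirectLimit.
Local Open Scope group_scope.
Local Open Scope quotient_scope.

Record direct_system := DirectSystem {
  ds_group :> nat -> groupType;
  ds_map : forall n, {multiplicative ds_group n -> ds_group n.+1}
}.

Variable (D : direct_system).

(* The disjoint union of the groups, on which the transition maps act as a
   single self-map; [ds_rel] identifies two elements as soon as they have a
   common image further in the sequence. *)
Definition ds_union : Type := {n : nat & D n}.
HB.instance Definition _ := Choice.on ds_union.

Definition ds_tag n (x : D n) : ds_union := existT (fun n => D n : Type) n x.

Definition ds_step (p : ds_union) : ds_union :=
  ds_tag (ds_map D _ (tagged p)).

Definition ds_rel : rel ds_union := fun p q =>
  `[< exists k l, iter k ds_step p = iter l ds_step q >].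

Let ds_refl : reflexive ds_rel.
Proof. by move=> p; apply/asboolP; exists 0%N, 0%N. Qed.

Let ds_sym : symmetric ds_rel.
Proof.
suff H p q : ds_rel p q -> ds_rel q p by move=> p q; apply/idP/idP; exact: H.
by move=> /asboolP[k [l e]]; apply/asboolP; exists l, k.
Qed.

Let ds_trans : transitive ds_rel.
Proof.
move=> q p r /asboolP[k [l e]] /asboolP[m [n e']]; apply/asboolP.
exists (m + k)%N, (l + n)%N.
by rewrite iterD e -iterD addnC iterD e' -iterD.
Qed.

Canonical ds_equiv := EquivRel ds_rel ds_refl ds_sym ds_trans.

Definition direct_limit : Type := {eq_quot ds_equiv}.
HB.instance Definition _ := Choice.on direct_limit.
HB.instance Definition _ := EqQuotient.on direct_limit.

Definition ds_inj n (x : D n) : direct_limit := \pi_direct_limit (ds_tag x).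

Lemma ds_injP n m (x : D n) (y : D m) : ds_inj x = ds_inj y <->
  exists k l, iter k ds_step (ds_tag x) = iter l ds_step (ds_tag y).
Proof.
split=> [/eqquotP/asboolP//|H]; apply/eqquotP; exact/asboolP.
Qed.

Fixpoint ds_shift k n : D n -> D (k + n)%N :=
  if k is k'.+1 then fun x => ds_map D _ (ds_shift k' x) else id.

Lemma ds_shiftE k n (x : D n) :
  iter k ds_step (ds_tag x) = ds_tag (ds_shift k x).
Proof. by elim: k => //= k ->. Qed.

Lemma ds_shiftM k n : {morph @ds_shift k n : x y / x * y}.
Proof. by elim: k => //= k IH x y; rewrite IH gmulfM. Qed.

Lemma ds_shift1 k n : @ds_shift k n 1 = 1.
Proof. by elim: k => //= k ->; rewrite group_morph1. Qed.

Lemma ds_inj_step n (x : D n) : ds_inj (ds_map D n x) = ds_inj x.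
Proof. by apply/ds_injP; exists 0%N, 1%N. Qed.

Lemma ds_inj_shift k n (x : D n) : ds_inj (ds_shift k x) = ds_inj x.
Proof. by apply/ds_injP; exists 0%N, k; exact/esym/ds_shiftE. Qed.

Lemma ds_inj_cast n m (e : n = m) (x : D n) : ds_inj (ecast n (D n) e x) = ds_inj x.
Proof. by case: m / e. Qed.

(* Multiplication takes place in a group containing images of both factors. *)
Definition ds_mul (a b : direct_limit) : direct_limit :=
  let p := repr a in let q := repr b in
  ds_inj (ds_shift (tag q) (tagged p) *
          ecast n (D n) (addnC (tag p) (tag q)) (ds_shift (tag p) (tagged q))).
Definition ds_one : direct_limit := @ds_inj 0 1.
Definition ds_inv (a : direct_limit) : direct_limit :=
  ds_inj (tagged (repr a))^-1.

Lemma ds_reprK (a : direct_limit) : ds_inj (tagged (repr a)) = a.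
Proof.
transitivity (\pi_direct_limit (repr a)); last exact: reprK.
by rewrite /ds_inj; case: (repr a).
Qed.

Lemma ds_inj_surj (a : direct_limit) : exists n (x : D n), a = ds_inj x.
Proof.
by exists (tag (repr a)), (tagged (repr a)); rewrite ds_reprK.
Qed.

Lemma ds_inj_surj_leq (a : direct_limit) :
  exists n, forall i, (n <= i)%N -> exists x : D i, a = ds_inj x.
Proof.
have [n [x ->]] := ds_inj_surj a; exists n => i ni.
exists (ecast n (D n) (subnK ni) (ds_shift (i - n) x)).
by rewrite ds_inj_cast ds_inj_shift.
Qed.

Lemma ds_inj_surj3 (a b c : direct_limit) : exists n (x y z : D n),
  [/\ a = ds_inj x, b = ds_inj y & c = ds_inj z].
Proof.
have [k ak] := ds_inj_surj_leq a; have [l bl] := ds_inj_surj_leq b.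
have [m cm] := ds_inj_surj_leq c; exists (k + l + m)%N.
have [x ->] := ak _ (leq_trans (leq_addr l k) (leq_addr m _)).
have [y ->] := bl _ (leq_trans (leq_addl k l) (leq_addr m _)).
by have [z ->] := cm _ (leq_addl (k + l) m); exists x, y, z.
Qed.

Lemma ds_inj_eq n (x y : D n) : ds_inj x = ds_inj y <->
  exists k, ds_shift k x = ds_shift k y.
Proof.
split=> [/ds_injP[k [l]]|[k e]]; last first.
  by rewrite -(ds_inj_shift k) e ds_inj_shift.
rewrite !ds_shiftE => e.
have ekl : k = l by have /(congr1 (@tag _ _)) /= := e => /addIn.
move: e; rewrite -ekl => e; exists k.
by have /eqP := e; rewrite eq_Tagged /= => /eqP.
Qed.

Lemma ds_shift_leq n (x y : D n) j k : (k <= j)%N ->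
  ds_shift k x = ds_shift k y -> ds_shift j x = ds_shift j y.
Proof. by move=> /subnK <- e; elim: (j - k)%N => //= i ->. Qed.

Let ds_castM n m (e : n = m) :
  {morph (fun x => ecast n (D n) e x) : x y / x * y}.
Proof. by case: m / e. Qed.

Let ds_mul_eqn n (x x' y y' : D n) :
  ds_inj x = ds_inj x' -> ds_inj y = ds_inj y' ->
  ds_inj (x * y) = ds_inj (x' * y').
Proof.
move=> /ds_inj_eq[k ek] /ds_inj_eq[l el]; apply/ds_inj_eq.
exists (maxn k l); rewrite !ds_shiftM.
by rewrite (ds_shift_leq (leq_maxl k l) ek) (ds_shift_leq (leq_maxr k l) el).
Qed.

Let ds_mul_eq n n' (x y : D n) (x' y' : D n') :
  ds_inj x = ds_inj x' -> ds_inj y = ds_inj y' ->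
  ds_inj (x * y) = ds_inj (x' * y').
Proof.
move=> ex ey; rewrite -(ds_inj_shift n') -[RHS](ds_inj_shift n).
rewrite -(ds_inj_cast (addnC n n')) !ds_shiftM ds_castM.
by apply: ds_mul_eqn; rewrite ds_inj_cast !ds_inj_shift.
Qed.

Lemma ds_mulE n (x y : D n) : ds_mul (ds_inj x) (ds_inj y) = ds_inj (x * y).
Proof.
by apply: ds_mul_eq; rewrite ?ds_inj_cast ds_inj_shift ds_reprK.
Qed.

Lemma ds_invE n (x : D n) : ds_inv (ds_inj x) = ds_inj x^-1.
Proof.
have := ds_reprK (ds_inj x).
rewrite /ds_inv; move: (repr _) => [m y] /=.
have shV k i (z : D i) : ds_shift k z^-1 = (ds_shift k z)^-1.
  by apply/esym/mulg1_eq; rewrite -ds_shiftM mulgV ds_shift1.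
have castV i j (e : i = j) (z : D i) :
  ecast n (D n) e z^-1 = (ecast n (D n) e z)^-1 by case: j / e.
rewrite -(ds_inj_shift n y) -(ds_inj_shift m x) -(ds_inj_shift n y^-1).
rewrite -(ds_inj_shift m x^-1) -(ds_inj_cast (addnC n m) (ds_shift n y)).
rewrite -(ds_inj_cast (addnC n m) (ds_shift n y^-1)).
rewrite !shV castV => /ds_inj_eq[k ek]; apply/ds_inj_eq; exists k.
by rewrite !shV ek.
Qed.

Lemma ds_oneE n : ds_one = ds_inj (1 : D n).
Proof.
have cast1 i j (e : i = j) : ecast n (D n) e 1 = 1 by case: j / e.
by rewrite /ds_one -(ds_inj_shift n) ds_shift1 -(ds_inj_cast (addn0 n)) cast1.
Qed.

Let ds_mulA : associative ds_mul.
Proof.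
move=> a b c; have [n [x [y [z [-> -> ->]]]]] := ds_inj_surj3 a b c.
by rewrite !ds_mulE mulgA.
Qed.

Let ds_mul1g : left_id ds_one ds_mul.
Proof.
move=> a; have [n [x ->]] := ds_inj_surj a.
by rewrite (ds_oneE n) ds_mulE mul1g.
Qed.

Let ds_mulg1 : right_id ds_one ds_mul.
Proof.
move=> a; have [n [x ->]] := ds_inj_surj a.
by rewrite (ds_oneE n) ds_mulE mulg1.
Qed.

Let ds_mulVg : left_inverse ds_one ds_inv ds_mul.
Proof.
move=> a; have [n [x ->]] := ds_inj_surj a.
by rewrite ds_invE ds_mulE mulVg -ds_oneE.
Qed.

Let ds_mulgV : right_inverse ds_one ds_inv ds_mul.
Proof.
move=> a; have [n [x ->]] := ds_inj_surj a.
by rewrite ds_invE ds_mulE mulgV -ds_oneE.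
Qed.

HB.instance Definition _ := isGroup.Build direct_limit
  ds_mulA ds_mul1g ds_mulg1 ds_mulVg ds_mulgV.

Lemma ds_injM n : {morph @ds_inj n : x y / x * y}.
Proof. by move=> x y; rewrite -ds_mulE. Qed.

HB.instance Definition _ n :=
  isMultiplicative.Build (D n) direct_limit (@ds_inj n) (@ds_injM n).

End DirectLimit.

Section DirectLimitMap.
Local Open Scope group_scope.

Definition ds_compatible (D E : direct_system)
    (f : forall n, {multiplicative D n -> E n}) : Prop :=
  forall n (x : D n), f n.+1 (ds_map D n x) = ds_map E n (f n x).

Variables (D E : direct_system) (f : forall n, {multiplicative D n -> E n}).

Definition direct_limit_map (fC : ds_compatible f) (a : direct_limit D) :
  direct_limit E := ds_inj (f (tag (repr a)) (tagged (repr a))).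

Variable fC : ds_compatible f.

Lemma ds_shift_map k n (x : D n) :
  f (k + n)%N (ds_shift k x) = ds_shift k (f n x).
Proof. by elim: k => //= k IH; rewrite fC IH. Qed.

Lemma direct_limit_mapE n (x : D n) :
  direct_limit_map fC (ds_inj x) = ds_inj (f n x).
Proof.
have := ds_reprK (ds_inj x).
rewrite /direct_limit_map; move: (repr _) => [m y] /= /ds_injP[k [l]].
rewrite !ds_shiftE => e; rewrite -(ds_inj_shift k) -[RHS](ds_inj_shift l).
rewrite -!ds_shift_map.
by have := congr1 (fun p : ds_union D => ds_inj (f (tag p) (tagged p))) e.
Qed.

Let direct_limit_mapM : {morph direct_limit_map fC : x y / x * y}.
Proof.
move=> a b; have [n [x [y [_ [-> -> _]]]]] := ds_inj_surj3 a b b.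
by rewrite -gmulfM !direct_limit_mapE gmulfM; exact: gmulfM.
Qed.

HB.instance Definition _ := isMultiplicative.Build _ _ (direct_limit_map fC)
  direct_limit_mapM.

End DirectLimitMap.

(* A join of the library's normed modules and algebras cannot be declared as an
   HB structure: numDomainType already inherits from both.  A Banach algebra is
   therefore packed as a complete normed module with a multiplication, and its
   carrier is then given the library's algebra structure.  The unit need not have
   norm 1, which fails for the sum norm on matrices. *)
Record banachAlgType (K : numFieldType) := BanachAlgType {
  banach_space : completeNormedModType K;
  banach_one : banach_space;
  banach_mul : banach_space -> banach_space -> banach_space;
  banach_mulA : associative banach_mul;
  banach_mul1x : left_id banach_one banach_mul;
  banach_mulx1 : right_id banach_one banach_mul;
  banach_mulDl : left_distributive banach_mul +%R;
  banach_mulDr : right_distributive banach_mul +%R;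
  banach_one_neq0 : banach_one != 0;
  banach_scaleAl : forall (k : K) (x y : banach_space),
    k *: banach_mul x y = banach_mul (k *: x) y;
  banach_scaleAr : forall (k : K) (x y : banach_space),
    k *: banach_mul x y = banach_mul x (k *: y);
  banach_normM : forall x y : banach_space, `|banach_mul x y| <= `|x| * `|y|
}.

Definition banach_sort (K : numFieldType) (A : banachAlgType K) : Type :=
  banach_space A.
Coercion banach_sort : banachAlgType >-> Sortclass.

Section BanachAlgebra.
Variables (K : numFieldType) (A : banachAlgType K).

HB.instance Definition _ := CompleteNormedModule.copy (banach_sort A)
  (banach_space A).
HB.instance Definition _ := GRing.Zmodule_isNzRing.Build (banach_sort A)
  (@banach_mulA K A) (@banach_mul1x K A) (@banach_mulx1 K A)
  (@banach_mulDl K A) (@banach_mulDr K A) (@banach_one_neq0 K A).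
HB.instance Definition _ := GRing.LSemiModule_isLSemiAlgebra.Build K
  (banach_sort A) (@banach_scaleAl K A).
HB.instance Definition _ := GRing.LSemiAlgebra_isSemiAlgebra.Build K
  (banach_sort A) (@banach_scaleAr K A).

Lemma normrM_le (x y : A) : `|x * y| <= `|x| * `|y|.
Proof. exact: banach_normM. Qed.

End BanachAlgebra.

Section Spectrum.

Definition invertible (R : nzRingType) : set R :=
  [set x | exists y, x * y = 1 /\ y * x = 1].

Definition spectrum (K : nzRingType) (A : algType K) (a : A) : set K :=
  [set l | ~ @invertible A (l%:A - a)].

(* A subalgebra is not required to contain the unit. *)
Definition is_subalgebra (K : nzRingType) (A : algType K) (X : {pred A}) :=
  GRing.submod_closed X /\ GRing.mulr_2closed X.

Definition relatively_spectral (K : numFieldType) (A B : banachAlgType K)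
    (phi : A -> B) : Prop :=
  exists X : {pred A}, [/\ is_subalgebra X, dense [set` X]
    & {in X, forall x, spectrum (phi x) = spectrum x}].

End Spectrum.

Section Lipschitz.
Variables (K : numFieldType) (V W : normedModType K).

Lemma lipschitz_continuous (f : V -> W) (k : K) : 0 <= k ->
  (forall x y, `|f x - f y| <= k * `|x - y|) -> continuous f.
Proof.
move=> k0 fk x; apply/cvgrPdist_lt => e e0.
have k1 : 0 < k + 1 by rewrite ltr_wpDl.
have : \forall y \near x, `|x - y| < e / (k + 1).
  by apply: cvgr_dist_lt; rewrite ?divr_gt0.
apply: filterS => y /= xy; apply: (le_lt_trans (fk _ _)).
rewrite (@le_lt_trans _ _ ((k + 1) * `|x - y|))//.
  by rewrite ler_wpM2r// lerDl.
by rewrite mulrC -ltr_pdivlMr.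
Qed.

Lemma linear_lipschitz (f : {linear V -> W}) : continuous f ->
  exists2 k, 0 <= k & forall x, `|f x| <= k * `|x|.
Proof.
move=> /linear_bounded_continuous /linear_boundedP /pinfty_ex_gt0[k k0 H].
by exists k => //; exact: ltW.
Qed.

End Lipschitz.

Section GL.

Definition GL (R : nzRingType) : Type := {x : R | x \in @invertible R}.

Variable R : nzRingType.

HB.instance Definition _ := Choice.on (GL R).

Definition GLval (x : GL R) : R := sval x.

Lemma GLval_inj : injective GLval. Proof. exact: val_inj. Qed.

Lemma GLvalP (x : GL R) : invertible (GLval x).
Proof. by have := valP x; rewrite inE. Qed.

Definition mkGL (x : R) (Hx : invertible x) : GL R := exist _ x (mem_set Hx).

Lemma invertible1 : @invertible R 1.
Proof. by exists 1; rewrite mulr1. Qed.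

Lemma invertibleM (x y : R) : invertible x -> invertible y -> invertible (x * y).
Proof.
move=> [x' [xx' x'x]] [y' [yy' y'y]]; exists (y' * x'); split.
  by rewrite mulrA -(mulrA x) yy' mulr1.
by rewrite mulrA -(mulrA y') x'x mulr1.
Qed.

Definition GLinv_val (x : GL R) : R := projT1 (cid (GLvalP x)).

Lemma GLmulV (x : GL R) : GLval x * GLinv_val x = 1.
Proof. by rewrite /GLinv_val; case: cid => y []. Qed.

Lemma GLVmul (x : GL R) : GLinv_val x * GLval x = 1.
Proof. by rewrite /GLinv_val; case: cid => y []. Qed.

Lemma GLinv_invertible (x : GL R) : invertible (GLinv_val x).
Proof. by exists (GLval x); rewrite GLmulV GLVmul. Qed.

Definition GLone : GL R := mkGL invertible1.
Definition GLmul (x y : GL R) : GL R := mkGL (invertibleM (GLvalP x) (GLvalP y)).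
Definition GLinv (x : GL R) : GL R := mkGL (GLinv_invertible x).

Let GLmulA : associative GLmul.
Proof. by move=> x y z; apply: GLval_inj; exact: mulrA. Qed.
Let GLmul1g : left_id GLone GLmul.
Proof. by move=> x; apply: GLval_inj; exact: mul1r. Qed.
Let GLmulg1 : right_id GLone GLmul.
Proof. by move=> x; apply: GLval_inj; exact: mulr1. Qed.
Let GLmulVg : left_inverse GLone GLinv GLmul.
Proof. by move=> x; apply: GLval_inj; exact: GLVmul. Qed.
Let GLmulgV : right_inverse GLone GLinv GLmul.
Proof. by move=> x; apply: GLval_inj; exact: GLmulV. Qed.

HB.instance Definition _ := isGroup.Build (GL R)
  GLmulA GLmul1g GLmulg1 GLmulVg GLmulgV.

Lemma GLval1 : GLval 1%g = 1. Proof. by []. Qed.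

Lemma GLvalM (x y : GL R) : GLval (x * y)%g = GLval x * GLval y.
Proof. by []. Qed.

Lemma GLvalV (x : GL R) : GLval x * GLval x^-1%g = 1.
Proof. exact: GLmulV. Qed.

Lemma GLVval (x : GL R) : GLval x^-1%g * GLval x = 1.
Proof. exact: GLVmul. Qed.

End GL.

Section GLMap.
Variables (R S : nzRingType) (f : R -> S).
Hypotheses (f1 : f 1 = 1) (fM : {morph f : x y / x * y}).

Lemma invertible_morph x : invertible x -> invertible (f x).
Proof. by move=> [y [xy yx]]; exists (f y); rewrite -!fM xy yx. Qed.

Definition GL_map_fun (x : GL R) : GL S := mkGL (invertible_morph (GLvalP x)).

Lemma GL_map_funM : {morph GL_map_fun : x y / (x * y)%g}.
Proof. by move=> x y; apply: GLval_inj; exact: fM. Qed.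

Definition GL_map : {multiplicative GL R -> GL S} :=
  HB.pack GL_map_fun (isMultiplicative.Build _ _ GL_map_fun GL_map_funM).

Lemma GLval_map x : GLval (GL_map x) = f (GLval x). Proof. by []. Qed.

End GLMap.

Section GL0.
Variables (K : numFieldType) (A : banachAlgType K).

Definition GL0 : set A := connected_component (@invertible A) 1.

Lemma mull_continuous (a : A) : continuous (fun x : A => a * x).
Proof.
apply: (@lipschitz_continuous K A A _ `|a|) => // x y.
by rewrite -mulrBr normrM_le.
Qed.

Lemma mulr_continuous (a : A) : continuous (fun x : A => x * a).
Proof.
apply: (@lipschitz_continuous K A A _ `|a|) => // x y.
by rewrite -mulrBl mulrC normrM_le.
Qed.

Lemma GL0_invertible (x : A) : GL0 x -> invertible x.
Proof. exact: connected_component_sub. Qed.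

Lemma GL0_1 : GL0 1.
Proof. by apply: connected_component_refl; exact: invertible1. Qed.

Lemma GL0_image (f : A -> A) x y : continuous f ->
  (forall z, invertible z -> invertible (f z)) -> GL0 x -> GL0 y ->
  connected_component (@invertible A) (f x) (f y).
Proof.
move=> cf fI x0 y0.
apply: (@connected_component_max _ _ (f @` GL0)); last by exists y.
- by exists x.
- by move=> _ [z /GL0_invertible/fI ? <-].
- apply: connected_continuous_connected; first exact: component_connected.
  exact: continuous_subspaceT.
Qed.

Lemma GL0_M x y : GL0 x -> GL0 y -> GL0 (x * y).
Proof.
move=> x0 y0.
have := GL0_image (@mull_continuous x) (fun z => invertibleM (GL0_invertible x0))
  GL0_1 y0.
by rewrite mulr1; exact: connected_component_trans.
Qed.

Let GL0_normal1 : GL0 (GLval (1%g : GL A)). Proof. exact: GL0_1. Qed.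

Let GL0_normalM (x y : GL A) :
  GL0 (GLval x) -> GL0 (GLval y) -> GL0 (GLval (x * y)%g).
Proof. exact: GL0_M. Qed.

Let GL0_normalV (x : GL A) : GL0 (GLval x) -> GL0 (GLval x^-1%g).
Proof.
move=> x0.
have := GL0_image (@mull_continuous (GLval x^-1%g))
  (fun z => invertibleM (GLvalP x^-1%g)) x0 GL0_1.
by rewrite GLVval mulr1.
Qed.

Let GL0_normalJ (x y : GL A) : GL0 (GLval x) -> GL0 (GLval (x ^ y)%g).
Proof.
move=> x0; rewrite conjgE !GLvalM.
have cf : continuous (fun z : A => GLval y^-1%g * (z * GLval y)).
  move=> z; apply: (@continuous_comp _ _ _ (fun u : A => u * GLval y)
    (fun u : A => GLval y^-1%g * u)); first exact: mulr_continuous.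
  exact: mull_continuous.
have := GL0_image cf (fun z zi => invertibleM (GLvalP y^-1%g)
  (invertibleM zi (GLvalP y))) GL0_1 x0.
by rewrite mul1r GLVval.
Qed.

Definition GL0_normal : normal_subgroup (GL A) :=
  NormalSubgroup GL0_normal1 GL0_normalM GL0_normalV GL0_normalJ.

Definition GL_mod_GL0 : groupType := quotient_group GL0_normal.

End GL0.

Section GL0Map.
Variables (K : numFieldType) (A B : banachAlgType K) (f : A -> B).
Hypotheses (f1 : f 1 = 1) (fM : {morph f : x y / x * y}) (fC : continuous f).

Lemma GL0_morph x : GL0 x -> GL0 (f x).
Proof.
move=> x0; apply: (@connected_component_max _ _ (f @` @GL0 K A)).
- by exists 1; [exact: GL0_1|].
- by move=> _ [z /GL0_invertible/(invertible_morph f1 fM) ? <-].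
- apply: connected_continuous_connected; first exact: component_connected.
  exact: continuous_subspaceT.
- by exists x.
Qed.

Definition GL_mod_GL0_map : {multiplicative GL_mod_GL0 A -> GL_mod_GL0 B} :=
  @quotient_map _ _ (GL0_normal A) (GL0_normal B) (GL_map f1 fM)
    (fun x => @GL0_morph (GLval x)).

End GL0Map.

Section MatrixNorm.
Variables (K : numFieldType) (A : banachAlgType K).

Definition mx_norm1 m n (M : 'M[A]_(m, n)) : K := \sum_i \sum_j `|M i j|.

Lemma mx_norm1_ge0 m n (M : 'M[A]_(m, n)) : 0 <= mx_norm1 M.
Proof. by apply: sumr_ge0 => i _; apply: sumr_ge0. Qed.

Lemma le_entry_mx_norm1 m n (M : 'M[A]_(m, n)) i j : `|M i j| <= mx_norm1 M.
Proof.
rewrite /mx_norm1 (bigD1 i)//= (bigD1 j)//= -addrA lerDl.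
by rewrite addr_ge0 ?sumr_ge0// => k _; rewrite sumr_ge0.
Qed.

Lemma mx_norm1D m n (M N : 'M[A]_(m, n)) :
  mx_norm1 (M + N) <= mx_norm1 M + mx_norm1 N.
Proof.
rewrite -big_split ler_sum// => i _; rewrite -big_split ler_sum// => j _.
by rewrite mxE ler_normD.
Qed.

Lemma mx_norm1_eq0 m n (M : 'M[A]_(m, n)) : mx_norm1 M = 0 -> M = 0.
Proof.
move=> M0; apply/matrixP => i j; rewrite mxE; apply/normr0_eq0/le_anti.
by rewrite normr_ge0 andbT -M0 le_entry_mx_norm1.
Qed.

Lemma mx_norm1M m n p (M : 'M[A]_(m, n)) (N : 'M[A]_(n, p)) :
  mx_norm1 (M *m N) <= mx_norm1 M * mx_norm1 N.
Proof.
rewrite {1}/mx_norm1; apply: (@le_trans _ _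
  (\sum_i \sum_j \sum_k `|M i k| * `|N k j|)).
  apply: ler_sum => i _; apply: ler_sum => j _; rewrite mxE.
  by apply: (le_trans (ler_norm_sum _ _ _)); apply: ler_sum => k _; exact: normrM_le.
rewrite {1}/mx_norm1 mulr_suml ler_sum// => i _.
rewrite exchange_big mulr_suml ler_sum// => k _ /=.
rewrite -mulr_sumr ler_wpM2l// /mx_norm1 (bigD1 k)//= lerDl.
by apply: sumr_ge0 => l _; apply: sumr_ge0.
Qed.

Definition normed_mx (n : nat) : Type := 'M[A]_n.+1.

Variable n : nat.

HB.instance Definition _ := GRing.Zmodule.copy (normed_mx n) 'M[A]_n.+1.

Definition mx_scale (k : K) (M : normed_mx n) : normed_mx n :=
  \matrix_(i, j) (k *: (M : 'M[A]__) i j).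

Let mx_scaleA a b M : mx_scale a (mx_scale b M) = mx_scale (a * b) M.
Proof. by apply/matrixP => i j; rewrite !mxE scalerA. Qed.
Let mx_scale1 : left_id 1 mx_scale.
Proof. by move=> M; apply/matrixP => i j; rewrite !mxE scale1r. Qed.
Let mx_scaleDr : right_distributive mx_scale +%R.
Proof. by move=> k M N; apply/matrixP => i j; rewrite !mxE scalerDr. Qed.
Let mx_scaleDl M : {morph mx_scale^~ M : a b / a + b}.
Proof. by move=> k l; apply/matrixP => i j; rewrite !mxE scalerDl. Qed.

HB.instance Definition _ := GRing.Zmodule_isLmodule.Build K (normed_mx n)
  mx_scaleA mx_scale1 mx_scaleDr mx_scaleDl.

Let mx_norm1Z (k : K) (M : normed_mx n) : mx_norm1 (k *: M) = `|k| * mx_norm1 M.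
Proof.
rewrite /mx_norm1 mulr_sumr; apply: eq_bigr => i _; rewrite mulr_sumr.
by apply: eq_bigr => j _; rewrite mxE normrZ.
Qed.

HB.instance Definition _ := Lmodule_isNormed.Build K (normed_mx n)
  (@mx_norm1D n.+1 n.+1) mx_norm1Z (@mx_norm1_eq0 n.+1 n.+1).

Lemma normed_mxE (M : normed_mx n) : `|M| = mx_norm1 M. Proof. by []. Qed.

Let normed_mx_complete (F : set_system (normed_mx n)) :
  ProperFilter F -> cauchy F -> cvg F.
Proof.
move=> FF /cauchyP Fc; pose ent i j (M : normed_mx n) : A := M i j.
have ent_cvg i j : cvg (ent i j @ F).
  apply: cauchy_cvg; apply/cauchyP => e e0; have [M FM] := Fc e e0.
  exists (ent i j M); apply: (@filterS _ F _ _ (ent i j @^-1` _) _ FM) => N.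
  rewrite -!ball_normE /=.
  apply: le_lt_trans; have := le_entry_mx_norm1 ((M : 'M[A]_n.+1) - (N : 'M[A]_n.+1)) i j.
  by rewrite !mxE.
pose L : normed_mx n := \matrix_(i, j) lim (ent i j @ F).
apply/cvg_ex; exists L; apply/(@cvgrPdist_lt _ _ _ F _ id) => e e0 /=.
pose d : K := e / (n.+1 * n.+1).+1%:R.
have d0 : 0 < d by rewrite divr_gt0.
have H i : \forall M \near F, forall j, `|lim (ent i j @ F) - ent i j M| < d.
  by apply: filter_forall => j; move/cvgrPdist_lt: (ent_cvg i j); exact.
have {}H := filter_forall (@filter_filter _ _ FF) H.
apply: (@filterS _ F _ _ _ _ H) => M {}H.
apply: (@le_lt_trans _ _ (\sum_(i < n.+1) \sum_(j < n.+1) d)).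
  apply: ler_sum => i _; apply: ler_sum => j _; rewrite !mxE; exact/ltW/H.
rewrite !sumr_const !card_ord -mulrnA -[_ *+ _]mulr_natr /d mulrAC.
by rewrite ltr_pdivrMr// ltr_pM2l// ltr_nat.
Qed.

HB.instance Definition _ := Uniform_isComplete.Build (normed_mx n)
  normed_mx_complete.

Let mx_scaleAl (k : K) (M N : normed_mx n) :
  k *: ((M : 'M[A]__) *m N : normed_mx n) = ((k *: M : normed_mx n) : 'M[A]__) *m N.
Proof.
apply/matrixP => i j; rewrite !mxE scaler_sumr; apply: eq_bigr => l _.
by rewrite mxE scalerAl.
Qed.

Let mx_scaleAr (k : K) (M N : normed_mx n) :
  k *: ((M : 'M[A]__) *m N : normed_mx n) = (M : 'M[A]__) *m (k *: N : normed_mx n).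
Proof.
apply/matrixP => i j; rewrite !mxE scaler_sumr; apply: eq_bigr => l _.
by rewrite mxE scalerAr.
Qed.

(* The index is shifted: [mx_banach n] consists of matrices of size n.+1. *)
Definition mx_banach : banachAlgType K := @BanachAlgType K (normed_mx n)
  (1%:M : 'M[A]_n.+1) (@mulmx A n.+1 n.+1 n.+1)
  (@mulmxA A _ _ _ _) (@mul1mx A _ _) (@mulmx1 A _ _)
  (@mulmxDl A _ _ _) (@mulmxDr A _ _ _) (@oner_neq0 'M[A]_n.+1)
  mx_scaleAl mx_scaleAr (@mx_norm1M _ _ _).

End MatrixNorm.

Section DiagOne.
Variables (K : numFieldType) (A : banachAlgType K) (n : nat).

Definition diag1 (M : mx_banach A n) : mx_banach A n.+1 :=
  castmx (addn1 n.+1, addn1 n.+1) (block_mx (M : 'M[A]_n.+1) 0 0 (1%:M : 'M[A]_1)).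

Let castmx1 m p (e : m = p) : castmx (e, e) 1%:M = 1%:M :> 'M[A]_p.
Proof. by case: p / e. Qed.

Let castmxM m p (e : m = p) (M N : 'M[A]_m) :
  castmx (e, e) (M *m N) = castmx (e, e) M *m castmx (e, e) N.
Proof. by case: p / e. Qed.

Let mx_norm1_cast m p (e : m = p) (M : 'M[A]_m) :
  mx_norm1 (castmx (e, e) M) = mx_norm1 M.
Proof. by case: p / e. Qed.

Let castmxB m p (e : m = p) (M N : 'M[A]_m) :
  castmx (e, e) M - castmx (e, e) N = castmx (e, e) (M - N).
Proof. by case: p / e. Qed.

Lemma diag1_1 : diag1 1 = 1.
Proof.
rewrite /diag1 -[(1 : mx_banach A n) : 'M[A]_n.+1]/(1%:M) -scalar_mx_block.
exact: castmx1.
Qed.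

Lemma diag1M : {morph diag1 : M N / M * N}.
Proof.
move=> M N; rewrite /diag1.
rewrite -[(M * N : mx_banach A n) : 'M[A]_n.+1]/((M : 'M[A]_n.+1) *m N).
rewrite -[RHS]/(castmx _ _ *m castmx _ _ : 'M[A]_n.+2) -castmxM mulmx_block.
by rewrite !mulmx0 !mul0mx !mulmx1 !addr0 !add0r.
Qed.

Lemma diag1_continuous : continuous diag1.
Proof.
apply: (@lipschitz_continuous K (mx_banach A n) (mx_banach A n.+1) _ 1) => // M N.
rewrite mul1r -[X in X <= _]/(mx_norm1 ((diag1 M : 'M[A]_n.+2) - diag1 N)).
rewrite -[X in _ <= X]/(mx_norm1 ((M : 'M[A]_n.+1) - N)) /diag1.
rewrite castmxB mx_norm1_cast opp_block_mx add_block_mx.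
rewrite !subrr /mx_norm1 !big_split_ord /=.
rewrite [X in _ + X]big1 ?addr0 => [|i _].
  apply: ler_sum => i _; rewrite big_split_ord /= [X in _ + X]big1 ?addr0.
    by apply: ler_sum => j _; rewrite block_mxEul.
  by move=> j _; rewrite block_mxEur mxE normr0.
rewrite big_split_ord /= !big1 ?addr0// => j _.
  by rewrite block_mxEdr mxE normr0.
by rewrite block_mxEdl mxE normr0.
Qed.

End DiagOne.

Definition K1_system (K : numFieldType) (A : banachAlgType K) : direct_system :=
  DirectSystem (fun n =>
    GL_mod_GL0_map (diag1_1 A n) (@diag1M K A n) (@diag1_continuous K A n)).

Definition K1 (K : numFieldType) (A : banachAlgType K) : groupType :=
  direct_limit (K1_system A).

Definition K1_class (K : numFieldType) (A : banachAlgType K) (n : nat)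
    (x : GL (mx_banach A n)) : K1 A :=
  @ds_inj (K1_system A) n (quotient_proj (GL0_normal (mx_banach A n)) x).

Section K1Map.
Variables (K : numFieldType) (A B : banachAlgType K) (phi : {lrmorphism A -> B}).

Definition mx_map n (M : mx_banach A n) : mx_banach B n :=
  map_mx phi (M : 'M[A]_n.+1).

Lemma mx_map1 n : @mx_map n 1 = 1.
Proof. exact: (map_mx1 phi). Qed.

Lemma mx_mapM n : {morph @mx_map n : M N / M * N}.
Proof. by move=> M N; exact: (map_mxM phi). Qed.

Hypothesis phi_continuous : continuous phi.

Lemma mx_map_continuous n : continuous (@mx_map n).
Proof.
have [k k0 phik] := linear_lipschitz phi_continuous.
apply: (@lipschitz_continuous K (mx_banach A n) (mx_banach B n) _ k) => // M N.
rewrite -[X in X <= _]/(mx_norm1 (map_mx phi M - map_mx phi N)).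
rewrite -[X in _ <= _ * X]/(mx_norm1 ((M : 'M[A]_n.+1) - N)) /mx_norm1 mulr_sumr.
apply: ler_sum => i _; rewrite mulr_sumr; apply: ler_sum => j _.
by rewrite !mxE -raddfB; exact: phik.
Qed.

Definition K1_system_map n : {multiplicative K1_system A n -> K1_system B n} :=
  GL_mod_GL0_map (mx_map1 n) (@mx_mapM n) (@mx_map_continuous n).

Lemma mx_map_diag1 n (M : mx_banach A n) : mx_map (diag1 M) = diag1 (mx_map M).
Proof.
by rewrite /mx_map /diag1 map_castmx map_block_mx !map_mx0 map_mx1.
Qed.

Lemma K1_system_map_compatible : ds_compatible K1_system_map.
Proof.
move=> n a; have [x ->] := quotient_proj_surj a.
rewrite /= !quotient_mapE; congr (quotient_proj _ _).
apply: GLval_inj; exact: mx_map_diag1.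
Qed.

Definition K1_map : {multiplicative K1 A -> K1 B} :=
  direct_limit_map K1_system_map_compatible.

Lemma K1_mapE n (x : GL (mx_banach A n)) :
  K1_map (K1_class x) = K1_class (GL_map (mx_map1 n) (@mx_mapM n) x).
Proof.
rewrite /K1_class [LHS]direct_limit_mapE; congr (ds_inj _).
exact: quotient_mapE.
Qed.

End K1Map.

Lemma banach_cvgM (K : numFieldType) (A : banachAlgType K) (T : Type)
    (F : set_system T) (FF : Filter F) (f g : T -> A) (a b : A) :
  f @ F --> a -> g @ F --> b -> (fun t => f t * g t) @ F --> a * b.
Proof.
move=> fa gb; have nf : `|a - f x| @[x --> F] --> (0 : K).
  by rewrite -[0](@normr0 _ A) -(subrr a); apply: cvg_norm; exact: cvgB (cvg_cst _) fa.
have ng : `|b - g x| @[x --> F] --> (0 : K).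
  by rewrite -[0](@normr0 _ A) -(subrr b); apply: cvg_norm; exact: cvgB (cvg_cst _) gb.
have h : (fun x => `|a - f x| * `|b| + `|a| * `|b - g x|
    + `|a - f x| * `|b - g x|) @ F --> (0 : K).
  rewrite -[0](_ : 0 * `|b| + `|a| * 0 + 0 * 0 = 0 :> K); last first.
    by rewrite !(mul0r, mulr0, addr0).
  by apply: cvgD; [apply: cvgD; apply: cvgM|apply: cvgM] => //; exact: cvg_cst.
apply/cvgrPdist_lt => e e0; move/cvgrPdist_lt : h => /(_ e e0).
apply: filterS => x; rewrite sub0r normrN; apply: le_lt_trans.
rewrite [leRHS]ger0_norm ?addr_ge0 ?mulr_ge0//.
have -> : a * b - f x * g x =
    (a - f x) * b + a * (b - g x) - (a - f x) * (b - g x).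
  rewrite addrAC -mulrBr opprB addrCA subrr addr0.
  by rewrite mulrBl mulrBr addrC addrA subrK.
rewrite (le_trans (ler_normB _ _))// lerD ?normrM_le//.
by rewrite (le_trans (ler_normD _ _))// lerD ?normrM_le.
Qed.

Section Suspension.
Variable R : realType.
Local Notation C := R[i].

Definition unit_interval : Type := set_type (`[0%R, 1%R]%classic : set R).
HB.instance Definition _ := Topological.on unit_interval.

Let in01_0 : (0 : R) \in (`[0%R, 1%R]%classic : set R).
Proof. by rewrite inE /= in_itv /= lexx ler01. Qed.
Let in01_1 : (1 : R) \in (`[0%R, 1%R]%classic : set R).
Proof. by rewrite inE /= in_itv /= lexx ler01. Qed.

Definition I0 : unit_interval := exist _ 0 in01_0.
Definition I1 : unit_interval := exist _ 1 in01_1.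

Variable A : banachAlgType C.

Definition susp_pred : {pred unit_interval -> A} := fun f =>
  `[< continuous f /\ exists c : C, f I0 = c%:A /\ f I1 = c%:A >].

Definition susp_space : Type := {f : unit_interval -> A | f \in susp_pred}.

HB.instance Definition _ := SubChoice.on susp_space.

Let susp_zmod_closed : zmod_closed susp_pred.
Proof.
split=> [|f g]; rewrite /in_mem /=.
  apply/asboolP; split; first exact: cst_continuous.
  by exists 0; rewrite scale0r.
move=> /asboolP[cf [c [f0 f1]]] /asboolP[cg [d [g0 g1]]]; apply/asboolP.
split.
  by move=> t; apply: (@cvgB _ _ _ (nbhs t) _ f g); [exact: cf|exact: cg].
exists (c - d); rewrite scalerBl.
by split; [rewrite -f0 -g0|rewrite -f1 -g1].
Qed.

Let susp_scale_closed : GRing.scaler_closed susp_pred.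
Proof.
move=> k f /asboolP[cf [c [f0 f1]]]; apply/asboolP; split.
  by move=> t; apply: (@cvgZ _ _ _ (nbhs t) _ (cst k) f); [exact: cvg_cst|exact: cf].
exists (k * c); rewrite -scalerA.
by split; [rewrite -f0|rewrite -f1].
Qed.

HB.instance Definition _ := GRing.isZmodClosed.Build _ susp_pred susp_zmod_closed.
HB.instance Definition _ := GRing.isScaleClosed.Build _ _ susp_pred susp_scale_closed.
HB.instance Definition _ := [SubChoice_isSubZmodule of susp_space by <:].
HB.instance Definition _ := [SubZmodule_isSubLmodule of susp_space by <:].

Definition susp_fun (f : susp_space) : unit_interval -> A := val f.

Lemma susp_continuous f : continuous (susp_fun f).
Proof. by have /asboolP[] := valP f. Qed.

Lemma susp_scalar f : exists c : C, susp_fun f I0 = c%:A /\ susp_fun f I1 = c%:A.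
Proof. by have /asboolP[] := valP f. Qed.

Definition mksusp (f : unit_interval -> A) (cf : continuous f)
    (f01 : exists c : C, f I0 = c%:A /\ f I1 = c%:A) : susp_space :=
  exist _ f (asboolT (conj cf f01)).

Lemma susp_eqP f g : susp_fun f =1 susp_fun g -> f = g.
Proof. by move=> fg; apply: val_inj; exact/funext. Qed.

Lemma susp_funD f g t : susp_fun (f + g) t = susp_fun f t + susp_fun g t.
Proof. by []. Qed.

Lemma susp_funB f g t : susp_fun (f - g) t = susp_fun f t - susp_fun g t.
Proof. by []. Qed.

Lemma susp_funZ k f t : susp_fun (k *: f) t = k *: susp_fun f t.
Proof. by []. Qed.

Let RenormK (x : A) : (complex.Re `|x|)%:C%C = `|x|.
Proof. by apply: RRe_real; exact: normr_real. Qed.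

(* Norms take their values in R[i]; the supremum is that of the real parts. *)
Definition susp_norm (f : susp_space) : C :=
  (sup (range (fun t => complex.Re `|susp_fun f t|)))%:C%C.

Let normRC (a : R) : `|a%:C%C| = `|a|%:C%C :> C.
Proof. by rewrite normc_def; congr (_%:C%C); rewrite /= expr0n addr0 sqrtr_sqr. Qed.

Let normRB (a b : R) : `|a%:C%C - b%:C%C| = `|a - b|%:C%C :> C.
Proof. by rewrite -normRC raddfB. Qed.

Let susp_bounded f : has_ubound (range (fun t => complex.Re `|susp_fun f t|)).
Proof.
pose h t := complex.Re `|susp_fun f t|.
pose g (x : R) : R := if pselect (x \in (`[0%R, 1%R]%classic : set R)) is left p
  then h (exist _ x p) else 0.
have gh : sigL (`[0%R, 1%R]%classic : set R) g = h.
  apply/funext => -[x xI]; rewrite /sigL /= /g.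
  by case: pselect => // p; congr (h (exist _ _ _)); exact: Prop_irrelevance.
have ch : continuous (h : unit_interval -> R).
  move=> t; apply/(@cvgrPdist_lt _ _ _ (nbhs t) (nbhs_filter t)) => e e0.
  move: (@susp_continuous f t).
  move=> /(@cvgrPdist_lt _ _ _ (nbhs t) (nbhs_filter t)) /(_ e%:C%C).
  rewrite ltcR => /(_ e0); apply: filterS => s /=.
  rewrite -ltcR; apply: le_lt_trans.
  have := ler_dist_dist (susp_fun f t) (susp_fun f s).
  apply: le_trans.
  by rewrite -(RenormK (susp_fun f t)) -(RenormK (susp_fun f s)) normRB.
have cg : {within `[0%R, 1%R], continuous g}.
  by apply/subspace_sigL_continuousP; rewrite gh.
have [c _ cmax] := EVT_max (@ler01 R) cg.
exists (g c) => _ [[x xI] _ <-]; rewrite -[X in X <= _]/(h (exist _ x xI)) -gh.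
by apply: cmax; have := xI; rewrite inE.
Qed.

Lemma le_susp_norm f t : `|susp_fun f t| <= susp_norm f.
Proof.
rewrite -RenormK lecR; apply: ub_le_sup; first exact: susp_bounded.
by exists t.
Qed.

Lemma susp_norm_le f (c : C) :
  (forall t, `|susp_fun f t| <= c) -> susp_norm f <= c.
Proof.
move=> fc; have c0 : 0 <= c by exact: le_trans (fc I0).
have cE : (complex.Re c)%:C%C = c by apply: RRe_real; exact: ger0_real.
rewrite -cE lecR; apply: ge_sup; first by exists (complex.Re `|susp_fun f I0|), I0.
by move=> _ [t _ <-]; rewrite -lecR cE RenormK.
Qed.

Lemma susp_norm_ge0 f : 0 <= susp_norm f.
Proof. exact: le_trans (le_susp_norm f I0). Qed.

Let susp_normD f g : susp_norm (f + g) <= susp_norm f + susp_norm g.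
Proof.
apply: susp_norm_le => t; rewrite susp_funD.
by rewrite (le_trans (ler_normD _ _))// lerD ?le_susp_norm.
Qed.

Let susp_normZ (k : C) f : susp_norm (k *: f) = `|k| * susp_norm f.
Proof.
apply/le_anti/andP; split.
  apply: susp_norm_le => t; rewrite susp_funZ normrZ.
  by rewrite ler_wpM2l ?le_susp_norm.
have [->|k0] := eqVneq k 0; first by rewrite normr0 mul0r susp_norm_ge0.
rewrite -ler_pdivlMl ?normr_gt0//; apply: susp_norm_le => t.
by rewrite ler_pdivlMl ?normr_gt0// -normrZ -susp_funZ le_susp_norm.
Qed.

Let susp_norm_eq0 f : susp_norm f = 0 -> f = 0.
Proof.
move=> f0; apply: susp_eqP => t; apply/normr0_eq0/le_anti.
by rewrite normr_ge0 andbT -f0 le_susp_norm.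
Qed.

HB.instance Definition _ := Lmodule_isNormed.Build C susp_space
  susp_normD susp_normZ susp_norm_eq0.

Lemma susp_normE (f : susp_space) : `|f| = susp_norm f. Proof. by []. Qed.

Let susp_complete (F : set_system susp_space) :
  ProperFilter F -> cauchy F -> cvg F.
Proof.
move=> FF /cauchyP Fc; pose ev t (f : susp_space) : A := susp_fun f t.
have ev_cvg t : cvg (ev t @ F).
  apply: cauchy_cvg; apply/cauchyP => e e0; have [f Ff] := Fc e e0.
  exists (ev t f); apply: (@filterS _ F _ _ (ev t @^-1` _) _ Ff) => g.
  rewrite -!ball_normE /=; apply: le_lt_trans; exact: (le_susp_norm (f - g) t).
pose L t : A := lim (ev t @ F).
have unif (e : C) : 0 < e -> \forall f \near F, forall t, `|L t - ev t f| <= e.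
  move=> e0; have e3 : 0 < e / 3 by rewrite divr_gt0.
  have [f Ff] := Fc _ e3.
  apply: (@filterS _ F _ _ _ _ Ff) => g; rewrite -ball_normE /= => fg t.
  have Ht : \forall h \near F, `|L t - ev t h| < e / 3.
    by move/cvgrPdist_lt: (ev_cvg t); exact.
  have [h []] := @filter_ex _ _ FF _ (@filterI _ F _ _ _ Ht Ff).
  rewrite -ball_normE /= => Lh fh.
  have -> : L t - ev t g = (L t - ev t h) + (ev t h - ev t f) + (ev t f - ev t g).
    by rewrite !addrA !subrK.
  have -> : e = e / 3 + e / 3 + e / 3 by field.
  rewrite (le_trans (ler_normD _ _))// lerD//.
    rewrite (le_trans (ler_normD _ _))// lerD ?(ltW Lh)// distrC.
    exact: le_trans (le_susp_norm (f - h) t) (ltW fh).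
  exact: le_trans (le_susp_norm (f - g) t) (ltW fg).
have cL : continuous L.
  move=> t; apply/(@cvgrPdist_lt _ _ _ (nbhs t) (nbhs_filter t)) => e e0.
  have e3 : 0 < e / 3 by rewrite divr_gt0.
  have [f fL] := @filter_ex _ _ FF _ (unif _ e3).
  move: (@susp_continuous f t).
  move=> /(@cvgrPdist_lt _ _ _ (nbhs t) (nbhs_filter t)) /(_ _ e3).
  apply: filterS => s /= fts.
  have -> : L t - L s = (L t - ev t f) + (ev t f - ev s f) + (ev s f - L s).
    by rewrite !addrA !subrK.
  have -> : e = e / 3 + e / 3 + e / 3 by field.
  rewrite (le_lt_trans (ler_normD _ _))// ltr_leD//; last by rewrite distrC fL.
  by rewrite (le_lt_trans (ler_normD _ _))// ler_ltD.
have L01 : exists c : C, L I0 = c%:A /\ L I1 = c%:A.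
  pose c f : C := projT1 (cid (susp_scalar f)).
  have c0 f : ev I0 f = (c f)%:A by rewrite /c; case: cid => ? [].
  have c1 f : ev I1 f = (c f)%:A by rewrite /c; case: cid => ? [].
  have n0 : 0 < `|1 : A| by rewrite normr_gt0 oner_neq0.
  have cB f g : `|c f - c g| * `|1 : A| <= susp_norm (f - g).
    by rewrite -normrZ scalerBl -!c0; exact: (le_susp_norm (f - g) I0).
  have [z zP] : exists z : C, forall e, 0 < e ->
      \forall f \near F, `|z - c f| < e.
    have real_lim (r : C -> R) : (forall u v, `|r u - r v|%:C%C <= `|u - v|) ->
        exists a : R, forall e : R, 0 < e -> \forall f \near F, `|a - r (c f)| < e.
      move=> rB; have : cvg ((fun f => r (c f)) @ F).
        apply: cauchy_cvg; apply/cauchyP => e e0.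
        have en : 0 < e%:C%C * `|1 : A| by rewrite mulr_gt0// ltcR.
        have [f Ff] := Fc _ en; exists (r (c f)).
        apply: (@filterS _ F _ _ ((fun f => r (c f)) @^-1` _) _ Ff) => g.
        rewrite -!ball_normE /= => fg; rewrite -ltcR (le_lt_trans (rB _ _))//.
        by rewrite -(ltr_pM2r n0) (le_lt_trans (cB _ _)).
      move=> rF; exists (lim ((fun f => r (c f)) @ F)) => e e0.
      by move/cvgrPdist_lt: rF; exact.
    have [a aP] : exists a : R, forall e : R, 0 < e ->
        \forall f \near F, `|a - complex.Re (c f)| < e.
      apply: real_lim => u v; rewrite -raddfB; exact: normc_ge_Re.
    have [b bP] : exists b : R, forall e : R, 0 < e ->
        \forall f \near F, `|b - complex.Im (c f)| < e.
      apply: real_lim => u v; rewrite -raddfB normc_def lecR -sqrtr_sqr.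
      by rewrite ler_wsqrtr// lerDr sqr_ge0.
    exists (a +i* b)%C => e e0.
    have eE : (complex.Re e)%:C%C = e by apply: RRe_real; exact: gtr0_real.
    have re0 : 0 < complex.Re e / 2 by rewrite divr_gt0// -ltcR eE.
    apply: (@filterS _ F _ _ _ _ (@filterI _ F _ _ _ (aP _ re0) (bP _ re0))).
    move=> f [Ha Hb].
    have -> : (a +i* b)%C - c f =
        (a - complex.Re (c f))%:C%C + 'i%C * (b - complex.Im (c f))%:C%C.
      by rewrite [LHS]complexE; case: (c f).
    rewrite (le_lt_trans (ler_normD _ _))// normrM.
    have -> : `|'i%C : C| = 1.
      by rewrite normc_def /= expr0n expr1n add0r sqrtr1.
    by rewrite mul1r !normRC -raddfD -eE ltcR [ltRHS]splitr ltrD.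
  have cz : (fun f => (c f)%:A : A) @ F --> (z%:A : A).
    apply/(@cvgrPdist_lt _ _ _ F _ _) => e e0.
    have en : 0 < e / `|1 : A| by rewrite divr_gt0.
    apply: (@filterS _ F _ _ _ _ (zP _ en)) => f Hf.
    by rewrite -scalerBl normrZ -ltr_pdivlMr.
  exists z; split; apply: cvg_lim => //.
    by rewrite (_ : ev I0 = (fun f => (c f)%:A)) //; apply/funext.
  by rewrite (_ : ev I1 = (fun f => (c f)%:A)) //; apply/funext.
apply/cvg_ex; exists (mksusp cL L01); apply/(@cvgrPdist_le _ _ _ F _ id) => e e0.
apply: (@filterS _ F _ _ _ _ (unif e e0)) => f Hf.
exact: susp_norm_le.
Qed.

HB.instance Definition _ := Uniform_isComplete.Build susp_space susp_complete.

Let susp_one_scalar :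
  exists c : C, cst (1 : A) I0 = c%:A /\ cst (1 : A) I1 = c%:A.
Proof. by exists 1; rewrite scale1r. Qed.

Definition susp_one : susp_space :=
  mksusp (@cst_continuous unit_interval A 1) susp_one_scalar.

Let susp_mul_continuous (f g : susp_space) :
  continuous (fun t => susp_fun f t * susp_fun g t).
Proof.
move=> t; apply: (@banach_cvgM _ A _ (nbhs t)); exact: susp_continuous.
Qed.

Let susp_mul_scalar (f g : susp_space) : exists c : C,
  susp_fun f I0 * susp_fun g I0 = c%:A /\ susp_fun f I1 * susp_fun g I1 = c%:A.
Proof.
have [c [f0 f1]] := susp_scalar f; have [d [g0 g1]] := susp_scalar g.
by exists (c * d); rewrite f0 f1 g0 g1 -scalerAl mul1r scalerA.
Qed.

Definition susp_mul (f g : susp_space) : susp_space :=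
  mksusp (@susp_mul_continuous f g) (susp_mul_scalar f g).

Let susp_mulA : associative susp_mul.
Proof. by move=> f g h; apply: susp_eqP => t; exact: mulrA. Qed.
Let susp_mul1x : left_id susp_one susp_mul.
Proof. by move=> f; apply: susp_eqP => t; exact: mul1r. Qed.
Let susp_mulx1 : right_id susp_one susp_mul.
Proof. by move=> f; apply: susp_eqP => t; exact: mulr1. Qed.
Let susp_mulDl : left_distributive susp_mul +%R.
Proof. by move=> f g h; apply: susp_eqP => t; exact: mulrDl. Qed.
Let susp_mulDr : right_distributive susp_mul +%R.
Proof. by move=> f g h; apply: susp_eqP => t; exact: mulrDr. Qed.
Let susp_one_neq0 : susp_one != 0.
Proof.
apply/eqP => /(congr1 (fun f => susp_fun f I0)) /eqP.
by apply/negP; exact: (oner_neq0 A).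
Qed.
Let susp_scaleAl (k : C) f g : k *: susp_mul f g = susp_mul (k *: f) g.
Proof. by apply: susp_eqP => t; exact: scalerAl. Qed.
Let susp_scaleAr (k : C) f g : k *: susp_mul f g = susp_mul f (k *: g).
Proof. by apply: susp_eqP => t; exact: scalerAr. Qed.
Let susp_normM f g : susp_norm (susp_mul f g) <= susp_norm f * susp_norm g.
Proof.
apply: susp_norm_le => t; apply: (le_trans (normrM_le _ _)).
by apply: ler_pM => //; exact: le_susp_norm.
Qed.

(* This is (SA)^+: loops based at a scalar multiple of the unit. *)
Definition suspension : banachAlgType C := @BanachAlgType C susp_space
  susp_one susp_mul susp_mulA susp_mul1x susp_mulx1 susp_mulDl susp_mulDr
  susp_one_neq0 susp_scaleAl susp_scaleAr susp_normM.

End Suspension.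

Section SuspensionMap.
Variables (R : realType) (A B : banachAlgType R[i]).
Variables (phi : {lrmorphism A -> B}) (phi_continuous : continuous phi).

Let susp_map_fun_continuous (f : suspension A) :
  continuous (fun t => phi (susp_fun f t)).
Proof.
move=> t; apply: (@continuous_comp _ _ _ (susp_fun f) phi).
  exact: susp_continuous.
exact: phi_continuous.
Qed.

Let susp_map_fun_scalar (f : suspension A) : exists c : R[i],
  phi (susp_fun f (I0 R)) = c%:A /\ phi (susp_fun f (I1 R)) = c%:A.
Proof.
by have [c [f0 f1]] := susp_scalar f; exists c; rewrite f0 f1 linearZ rmorph1.
Qed.

Definition susp_map (f : suspension A) : suspension B :=
  mksusp (@susp_map_fun_continuous f) (susp_map_fun_scalar f).

Let susp_map_linear : linear susp_map.
Proof. by move=> k f g; apply: susp_eqP => t; exact: linearP. Qed.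

Let susp_map_monoid : monoid_morphism susp_map.
Proof.
split; first by apply: susp_eqP => t; exact: rmorph1.
by move=> f g; apply: susp_eqP => t; exact: rmorphM.
Qed.

HB.instance Definition _ := GRing.isLinear.Build R[i] (suspension A)
  (suspension B) _ susp_map susp_map_linear.
HB.instance Definition _ := GRing.isMonoidMorphism.Build (suspension A)
  (suspension B) susp_map susp_map_monoid.

Lemma susp_map_continuous : continuous susp_map.
Proof.
have [k k0 phik] := linear_lipschitz phi_continuous.
apply: (@lipschitz_continuous _ (suspension A) (suspension B) _ k) => // f g.
apply: susp_norm_le => t; rewrite susp_funB /= -raddfB.
apply: (le_trans (phik _)); rewrite ler_wpM2l//.
exact: (le_susp_norm (f - g : susp_space A) t).
Qed.

End SuspensionMap.

Section K0.
Variable R : realType.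

Definition K0 (A : banachAlgType R[i]) : groupType := K1 (suspension A).

Variables (A B : banachAlgType R[i]) (phi : {lrmorphism A -> B}).
Variable phi_continuous : continuous phi.

Definition K0_map : {multiplicative K0 A -> K0 B} :=
  K1_map (@susp_map_continuous R A B phi phi_continuous).

End K0.

(* Main.v *)
Require Import Defs.
From mathcomp Require Import all_boot all_order all_algebra.
From mathcomp Require Import complex.
From mathcomp Require Import all_classical all_reals all_analysis.
Import numFieldNormedType.Exports.
Set Implicit Arguments.
Unset Strict Implicit.
Unset Printing Implicit Defensive.
Import Order.TTheory GRing.Theory Num.Theory.

Local Open Scope classical_set_scope.
Local Open Scope ring_scope.

(** Relative spectrality controls invertibility of single elements of [A], not of
    matrices, so it cannot be applied directly to [GL_n].  What it provides is a
    linear subspace [Y] of [A], dense and containing the unit, whose elements are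
    invertible as soon as their images are ([spectral_subspace]): take all
    [l%:A - x] with [x] in the given subalgebra.  The rest of the argument uses
    only [Y] and the density of the range of [phi].

    For injectivity on every [GL_n / GL_n^0], and hence on the limit [K1], two
    facts local at [1] suffice ([reflects_GL0]): an invertible [w] over [A] with
    [phi w] close to [1] lies in [GL0] ([reflects_near1]), and every element
    close to [1] over [B] is a limit of images of elements of [GL0]
    ([covers_near1]).  The second one makes the closure [H] of [phi (GL0 A)],
    which is stable under products, open inside the invertible elements, so
    that [H] contains the connected set [GL0 B].  If then [phi a] is in [GL0 B],
    some [x] in [GL0 A] has [phi x] close to [phi a]; the first fact puts
    [a^-1 * x], and therefore [a], in [GL0 A].

    In size one, [y] in [Y] with [phi y] close to [1] is joined to [1] by a
    segment in [Y] whose image stays close to [1], hence consists of invertible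
    elements ([spectral_GL0]); both facts follow by density.  The size is then
    increased by elimination: once the corner [p] is invertible, a matrix is a
    product of unipotent factors, of [diag (p, 1)] and of [diag (1, Q)], where
    the Schur complement [Q] is again close to [1] ([schur_factorization],
    [schur_near1]).  Over [A] the corner is first moved into [Y], where it
    becomes invertible because its image is; [Q] is invertible because the whole
    matrix is, and although its entries have left [Y], only its corner has to be
    moved back at the next stage.

    For [K0 = K1 (suspension _)], the loops with values in [Y] form a spectral
    subspace of the suspension: a loop is invertible when its values are
    ([suspension_invertible]), and density, like the density of the range of
    [susp_map], comes from a partition of unity on the interval
    ([susp_approx]). *)

(** * Invertible elements near the unit and segments in [GL0] *)

Section Neumann.
Variables (R : realType) (A : banachAlgType R[i]).
Implicit Types x y : A.

Lemma normrX_le x n : `|x ^+ n| <= `|1 : A| * `|x| ^+ n.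
Proof.
elim: n => [|n IH]; first by rewrite !expr0 mulr1.
rewrite exprSr (le_trans (normrM_le _ _))// [in leRHS]exprSr mulrA.
by rewrite ler_wpM2r.
Qed.

Lemma Re_norm x : (complex.Re `|x|)%:C%C = `|x|.
Proof. by apply: RRe_real; exact: normr_real. Qed.

(** The norm is valued in [R[i]]; the comparison with a geometric series takes
    place in [R]. *)
Lemma is_cvg_neumann x : `|x| < 1 -> cvgn (series (fun k => x ^+ k)).
Proof.
move=> x1; apply: (@cauchy_cvg A); apply/cauchy_seriesP => e e0.
pose r : R := complex.Re `|x|; pose c : R := complex.Re `|1 : A|.
have r0 : 0 <= r by rewrite -lecR Re_norm; exact: normr_ge0.
have r1 : `|r| < 1 by rewrite ger0_norm// -ltcR Re_norm; exact: x1.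
have eE : (complex.Re e)%:C%C = e by apply: RRe_real; exact: gtr0_real.
have /cauchy_cvgP/cauchy_seriesP := is_cvg_geometric_series (a := c) r1.
move=> /(_ (complex.Re e)); rewrite -ltcR eE => /(_ e0).
apply: filterS => -[m n] /=; rewrite -ltcR eE; apply: le_lt_trans.
apply: (le_trans (ler_norm_sum _ _ _)).
have := ler_norm (\sum_(m <= k < n) geometric c r k); rewrite -lecR.
apply: le_trans; rewrite [leRHS]raddf_sum; apply: ler_sum => k _ /=.
by rewrite (le_trans (normrX_le _ _))// rmorphM rmorphXn /= !Re_norm.
Qed.

(** The limit [s] of the partial sums satisfies [s = 1 + x * s = 1 + s * x], by
    shifting the index of the series. *)
Lemma invertible_neumann x : `|x| < 1 -> invertible (1 - x).
Proof.
move=> x1; have /cvg_ex[s xs] := is_cvg_neumann x1.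
have sS : (fun n => series (fun k => x ^+ k) n.+1) @ \oo --> s.
  by rewrite -cvg_shiftS in xs.
have sl : (fun n => 1 + x * series (fun k => x ^+ k) n) @ \oo --> 1 + x * s.
  by apply: cvgD; [exact: cvg_cst|exact: continuous_cvg (@mull_continuous _ A x _) xs].
have sr : (fun n => 1 + series (fun k => x ^+ k) n * x) @ \oo --> 1 + s * x.
  by apply: cvgD; [exact: cvg_cst|exact: continuous_cvg (@mulr_continuous _ A x _) xs].
have E1 : s = 1 + x * s.
  apply: (norm_cvg_unique sS); apply: cvg_trans sl; apply: near_eq_cvg.
  apply: nearW => n; rewrite !seriesEnat /= big_nat_recl// expr0 mulr_sumr.
  by congr (_ + _); apply: eq_bigr => k _; rewrite exprS.
have E2 : s = 1 + s * x.
  apply: (norm_cvg_unique sS); apply: cvg_trans sr; apply: near_eq_cvg.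
  apply: nearW => n; rewrite !seriesEnat /= big_nat_recl// expr0 mulr_suml.
  by congr (_ + _); apply: eq_bigr => k _; rewrite exprSr.
exists s; rewrite mulrBl mulrBr mul1r mulr1.
by split; [rewrite {1}E1|rewrite {1}E2]; rewrite addrK.
Qed.

Lemma invertible_near1 x : `|x - 1| < 1 -> invertible x.
Proof.
by rewrite distrC => /invertible_neumann; rewrite opprB addrC subrK.
Qed.

End Neumann.

Section GL0Segment.
Variables (R : realType) (A : banachAlgType R[i]).
Implicit Types x y : A.

(** The segment is the continuous image of [[0, 1]], hence connected. *)
Lemma GL0_segment y :
  (forall t : R, 0 <= t <= 1 -> invertible (1 + t%:C%C *: (y - 1))) -> GL0 y.
Proof.
move=> H; pose g (t : R) : A := 1 + t%:C%C *: (y - 1).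
have cg : continuous g.
  move=> t; apply/cvgrPdist_lt => e e0.
  have n1 : 0 < `|y - 1| + 1 by rewrite ltr_wpDl.
  have d0 : 0 < complex.Re (e / (`|y - 1| + 1)).
    by rewrite -ltcR RRe_real ?divr_gt0// gtr0_real// divr_gt0.
  have : \forall s \near t, `|t - s| < complex.Re (e / (`|y - 1| + 1)).
    exact: (@cvgr_dist_lt R R^o R^o (nbhs t) _ id t cvg_id _ d0).
  apply: filterS => s; rewrite -ltcR RRe_real ?gtr0_real ?divr_gt0// => ts.
  rewrite /g opprD addrACA subrr add0r -scalerBl normrZ -raddfB.
  rewrite (@le_lt_trans _ _ (`|(t - s)%:C%C| * (`|y - 1| + 1)))//.
    by rewrite ler_wpM2l// lerDl.
  rewrite -ltr_pdivlMr// (le_lt_trans _ ts)// normc_def /=.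
  by rewrite expr0n addr0 sqrtr_sqr.
have conn : connected (g @` `[0, 1]).
  apply: connected_continuous_connected; first exact: segment_connected.
  exact: continuous_subspaceT.
apply: (@connected_component_max _ _ (g @` `[0, 1])) => //.
- by exists 0; rewrite /g ?scale0r ?addr0//= in_itv /= lexx ler01.
- by move=> _ [t /= + <-]; rewrite in_itv /=; exact: H.
- exists 1; first by rewrite /= in_itv /= lexx ler01.
  by rewrite /g scale1r addrC subrK.
Qed.

Lemma GL0_near1 y : `|y - 1| < 1 -> GL0 y.
Proof.
move=> y1; apply: GL0_segment => t /andP[t0 t1]; apply: invertible_near1.
rewrite addrAC subrr add0r normrZ (le_lt_trans _ y1)// -[leRHS]mul1r.
by rewrite ler_wpM2r// ger0_norm ?lecR.
Qed.

Lemma GL0V y z : y * z = 1 -> z * y = 1 -> GL0 y -> GL0 z.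
Proof.
move=> yz zy y0; have zi : invertible z by exists y.
have := nsgV (n := GL0_normal A) (x := mkGL (GL0_invertible y0)) y0.
suff -> : (mkGL (GL0_invertible y0))^-1%g = mkGL zi by [].
by apply/mulg1_eq/GLval_inj.
Qed.

(** An element [y] close to [x] is [x * (x^-1 * y)] with [x^-1 * y] in the unit
    ball around [1].  This allows [x] to be replaced by a better placed [y] when
    membership in [GL0] has to be shown. *)
Lemma near_GL0 x : invertible x ->
  \forall y \near x, invertible y /\ (GL0 y -> GL0 x).
Proof.
move=> [z [xz zx]].
have : (fun y => z * y) @ x --> (1 : A) by rewrite -zx; exact: mull_continuous.
move=> /cvgrPdist_lt /(_ 1 ltr01); apply: filterS => y.
rewrite distrC => zy1; have zy0 := GL0_near1 zy1.
have [u [zyu uzy]] := GL0_invertible zy0.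
have yu : y * u = x by rewrite -[y]mul1r -xz -!mulrA [z * _]mulrA zyu mulr1.
split; first by rewrite -[y]mul1r -xz -mulrA; apply: invertibleM;
  [exists z|exists u].
by move=> y0; rewrite -yu; apply: GL0_M => //; exact: (GL0V zyu uzy).
Qed.

End GL0Segment.

(** * From facts local at the unit to [GL0] *)

Section Closure.
Variables (K : numFieldType) (V W : normedModType K).

Lemma closure_normP (S : set V) b :
  closure S b <-> forall e, 0 < e -> exists2 x, S x & `|x - b| < e.
Proof.
split=> [Sb e e0|H U /nbhs_ballP[e /= e0 eU]].
  have [x [Sx]] := Sb _ (nbhsx_ballx b e e0).
  by rewrite -ball_normE /= distrC => xb; exists x.
have [x Sx xb] := H _ e0; exists x; split=> //; apply: eU.
by rewrite -ball_normE /= distrC.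
Qed.

Lemma dense_normP (S : set V) :
  dense S <-> forall b e, 0 < e -> exists2 x, S x & `|x - b| < e.
Proof.
split=> [Sd b e e0|H U [b Ub] oU].
  have [|x [+ Sx]] := Sd (ball b e) _ (ball_open b e).
    by exists b; exact: ballxx.
  by rewrite -ball_normE /= distrC => xb; exists x.
have /nbhs_ballP[e /= e0 eU] := open_nbhs_nbhs (conj oU Ub).
have [x Sx xb] := H b _ e0; exists x; split=> //; apply: eU.
by rewrite -ball_normE /= distrC.
Qed.

Lemma closure_continuous (g : V -> W) (S : set V) (T : set W) b :
  continuous g -> (forall x, S x -> closure T (g x)) -> closure S b ->
  closure T (g b).
Proof.
move=> cg ST; have cT : closed (g @^-1` closure T).
  by have /continuous_closedP := cg; apply; exact: closed_closure.
move=> Sb; rewrite -[closure T (g b)]/((g @^-1` closure T) b) ((closure_id _).1 cT).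
by apply: closureS Sb.
Qed.

End Closure.

Section ReflectGL0.
Variables (R : realType) (A B : banachAlgType R[i]) (f : A -> B).
Hypotheses (f1 : f 1 = 1) (fM : {morph f : x y / x * y}).

(** A local form, at the unit, of: [x] is in [GL0] as soon as [f x] is. *)
Definition reflects_near1 := exists2 e : R[i], 0 < e &
  forall w : A, invertible w -> `|f w - 1| < e -> GL0 w.

(** A local form, at the unit, of: [GL0 B] lies in the closure of [f (GL0 A)]. *)
Definition covers_near1 := exists2 e : R[i], 0 < e &
  forall b : B, `|b - 1| < e -> closure (f @` @GL0 _ A) b.

Lemma closure_imageM b c : closure (f @` @GL0 _ A) b ->
  closure (f @` @GL0 _ A) c -> closure (f @` @GL0 _ A) (b * c).
Proof.
move=> bH cH.
apply: (closure_continuous (@mulr_continuous _ B c) _ bH) => _ [x x0 <-].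
apply: (closure_continuous (@mull_continuous _ B (f x)) _ cH) => _ [y y0 <-].
by apply: subset_closure; exists (x * y); [exact: GL0_M|rewrite fM].
Qed.

(** [GL0 B] is connected, and its trace on the closure is closed by definition
    and open because a neighbourhood of an invertible [b] in the closure is
    obtained from a covered neighbourhood of [1] by multiplication by [b]. *)
Lemma GL0_sub_closure : covers_near1 ->
  @GL0 _ B `<=` closure (f @` @GL0 _ A).
Proof.
move=> [e e0 cov]; set H := closure _.
have inH b : H b -> invertible b -> interior H b.
  move=> Hb [c [bc cb]].
  have : (fun x => c * x) @ b --> (1 : B) by rewrite -cb; exact: mull_continuous.
  move=> /cvgrPdist_lt /(_ e e0); apply: filterS => x; rewrite distrC => /cov cx.
  by rewrite -[x]mul1r -bc -mulrA; exact: closure_imageM.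
suff <- : @GL0 _ B `&` H = @GL0 _ B by move=> x [].
apply: (@component_connected _ (@invertible B) 1).
- exists 1; split; first exact: GL0_1.
  by apply: subset_closure; exists 1 => //; exact: GL0_1.
- exists (interior H); first exact: open_interior.
  apply/seteqP; split=> x [x0]; last by move=> /interior_subset.
  by move=> Hx; split=> //; apply: inH => //; exact: GL0_invertible.
- by exists H => //; exact: closed_closure.
Qed.

(** With [f y] close to [f x] and [y] in [GL0], the element [x^-1 * y] is
    invertible with image close to [1]. *)
Lemma reflects_GL0 : reflects_near1 -> covers_near1 ->
  forall x : GL A, GL0 (f (Defs.GLval x)) -> GL0 (Defs.GLval x).
Proof.
move=> [e e0 refl] cov x /(GL0_sub_closure cov)/closure_normP fx.
have n0 : 0 < `|f (Defs.GLval x^-1%g)| + 1 by rewrite ltr_wpDl.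
have [_ [y y0 <-] yx] := fx (e / (`|f (Defs.GLval x^-1%g)| + 1)) (divr_gt0 e0 n0).
pose yG := mkGL (GL0_invertible y0).
have xy0 : GL0 (Defs.GLval (x^-1 * yG)%g).
  apply: refl; first exact: Defs.GLvalP.
  rewrite Defs.GLvalM fM -f1 -(GLVval x) fM -mulrBr.
  rewrite (le_lt_trans (normrM_le _ _))//.
  rewrite (@le_lt_trans _ _ ((`|f (Defs.GLval x^-1%g)| + 1) * `|f y - f (Defs.GLval x)|))//.
    by rewrite ler_wpM2r// lerDl.
  by rewrite mulrC -ltr_pdivlMr.
have -> : x = (yG * (x^-1 * yG)^-1)%g by rewrite invgM invgK mulVKg.
apply: GL0_M => //; exact: (nsgV (n := GL0_normal A) xy0).
Qed.

End ReflectGL0.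

(** * Elimination in matrices over a Banach algebra *)

Section PosLowerBound.
Variable K : numFieldType.

(** The order of [K] is only partial, so half the harmonic mean replaces the
    minimum. *)
Lemma pos_lower_bound (a b : K) : 0 < a -> 0 < b ->
  exists2 d, 0 < d & d <= a /\ d <= b.
Proof.
move=> a0 b0; have [ai bi] : 0 < a^-1 /\ 0 < b^-1 by rewrite !invr_gt0.
exists (a^-1 + b^-1)^-1; first by rewrite invr_gt0 addr_gt0.
split; rewrite -[leRHS]invrK lef_pV2 ?posrE ?addr_gt0//.
  by rewrite lerDl ltW.
by rewrite lerDr ltW.
Qed.

End PosLowerBound.

Section Blocks.
Variables (R : realType) (A : banachAlgType R[i]) (n : nat).
Implicit Types (M : mx_banach A n.+1) (p q : A).

Lemma mx_norm1_block m1 m2 n1 n2 (a : 'M[A]_(m1, n1)) (b : 'M[A]_(m1, n2))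
    (c : 'M[A]_(m2, n1)) (d : 'M[A]_(m2, n2)) :
  mx_norm1 (block_mx a b c d) =
  mx_norm1 a + mx_norm1 b + (mx_norm1 c + mx_norm1 d).
Proof.
rewrite /mx_norm1 big_split_ord /=; congr (_ + _); rewrite -big_split /=;
  apply: eq_bigr => i _; rewrite big_split_ord /=; congr (_ + _);
  by apply: eq_bigr => j _; rewrite ?block_mxEul ?block_mxEur ?block_mxEdl
    ?block_mxEdr.
Qed.

Lemma mx_norm1_scalar a : mx_norm1 (a%:M : 'M[A]_1) = `|a|.
Proof. by rewrite /mx_norm1 !big_ord1 mxE eqxx mulr1n. Qed.

Lemma mx_norm1_0 m1 n1 : mx_norm1 (0 : 'M[A]_(m1, n1)) = 0.
Proof. by rewrite /mx_norm1 big1// => i _; rewrite big1// => j _; rewrite mxE normr0. Qed.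

(** The pivot sits in the upper left corner, so that [1 + n.+1] is the size of
    [mx_banach A n.+1] without any cast. *)
Definition block_banach p (r : 'M[A]_(1, n.+1)) (s : 'M[A]_(n.+1, 1))
    (Q : mx_banach A n) : mx_banach A n.+1 :=
  block_mx (p%:M : 'M[A]_1) r s (Q : 'M[A]_n.+1).

Lemma block_banachE M : exists p r s Q, M = block_banach p r s Q.
Proof.
pose N : 'M[A]_(1 + n.+1) := M.
exists (ulsubmx N 0 0), (ursubmx N), (dlsubmx N), (drsubmx N).
by rewrite /block_banach -mx11_scalar submxK.
Qed.

Lemma block_banach_inj p r s Q p' r' s' Q' :
  block_banach p r s Q = block_banach p' r' s' Q' ->
  [/\ p = p', r = r', s = s' & Q = Q'].
Proof.
move=> /(@eq_block_mx _ 1 n.+1 1 n.+1)[/(congr1 (fun M : 'M[A]_1 => M 0 0))].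
by rewrite !mxE !eqxx !mulr1n => -> -> -> ->.
Qed.

Lemma block_banach1 : block_banach 1 0 0 1 = 1.
Proof. by rewrite -[RHS]/(1%:M : 'M[A]_(1 + n.+1)) scalar_mx_block. Qed.

Lemma block_banachM p r s Q p' r' s' Q' :
  block_banach p r s Q * block_banach p' r' s' Q' =
  block_banach (p * p' + (r *m s') 0 0) (p%:M *m r' + r *m (Q' : 'M[A]__))
    (s *m p'%:M + (Q : 'M[A]__) *m s')
    (s *m r' + (Q : 'M[A]__) *m (Q' : 'M[A]__) : 'M[A]__).
Proof.
rewrite -[LHS]/(block_mx (p%:M : 'M[A]_1) r s (Q : 'M[A]_n.+1) *m
  block_mx (p'%:M : 'M[A]_1) r' s' (Q' : 'M[A]_n.+1)).
have E : (p * p' + (r *m s') 0 0)%:M = p%:M *m p'%:M + r *m s' :> 'M[A]_1.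
  by rewrite raddfD /= scalar_mxM -mx11_scalar.
by rewrite mulmx_block /block_banach E.
Qed.

Lemma block_banachB p r s Q p' r' s' Q' :
  block_banach p r s Q - block_banach p' r' s' Q' =
  block_banach (p - p') (r - r') (s - s') (Q - Q').
Proof.
rewrite -[LHS]/(block_mx (p%:M : 'M[A]_1) r s (Q : 'M[A]_n.+1) -
  block_mx (p'%:M : 'M[A]_1) r' s' (Q' : 'M[A]_n.+1)).
by rewrite opp_block_mx add_block_mx /block_banach raddfB.
Qed.

Lemma block_banach0 : block_banach 0 0 0 0 = 0.
Proof. by rewrite -(subrr (block_banach 0 0 0 0)) block_banachB !subrr. Qed.

Lemma norm_block_banach p r s Q :
  `|block_banach p r s Q| = `|p| + mx_norm1 r + (mx_norm1 s + `|Q|).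
Proof.
rewrite -[LHS]/(mx_norm1 (block_mx (p%:M : 'M[A]_1) r s (Q : 'M[A]_n.+1))).
by rewrite mx_norm1_block mx_norm1_scalar.
Qed.

Lemma block_banach_corner_continuous r s (Q : mx_banach A n) :
  continuous (fun p => block_banach p r s Q).
Proof.
apply: (@lipschitz_continuous R[i] A (mx_banach A n.+1) _ 1) => // p q.
by rewrite mul1r block_banachB norm_block_banach !subrr normr0 !mx_norm1_0 !addr0.
Qed.

Definition corner p : mx_banach A n.+1 := block_banach p 0 0 1.
Definition tail (Q : mx_banach A n) : mx_banach A n.+1 := block_banach 1 0 0 Q.
Definition upper r : mx_banach A n.+1 := block_banach 1 r 0 1.
Definition lower s : mx_banach A n.+1 := block_banach 1 0 s 1.

Lemma cornerM : {morph corner : p q / p * q}.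
Proof.
move=> p q; rewrite /corner block_banachM !mul0mx !mulmx0 mxE !addr0 add0r.
by rewrite mulmx1.
Qed.

Lemma tailM : {morph tail : P Q / P * Q}.
Proof.
move=> P Q; rewrite /tail block_banachM !mul0mx !mulmx0 mxE !addr0 add0r.
by rewrite mulr1.
Qed.

Lemma corner_continuous : continuous corner.
Proof.
apply: (@lipschitz_continuous R[i] A (mx_banach A n.+1) _ 1) => // p q.
rewrite mul1r block_banachB norm_block_banach !subrr normr0 !mx_norm1_0.
by rewrite !addr0.
Qed.

Lemma tail_continuous : continuous tail.
Proof.
apply: (@lipschitz_continuous R[i] (mx_banach A n) (mx_banach A n.+1) _ 1) => //.
move=> P Q; rewrite mul1r block_banachB norm_block_banach !subrr normr0.
by rewrite !mx_norm1_0 !add0r.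
Qed.

Lemma GL0_corner p : GL0 p -> GL0 (corner p).
Proof. exact: (@GL0_morph _ _ _ corner (block_banach1) cornerM corner_continuous). Qed.

Lemma GL0_tail Q : GL0 Q -> GL0 (tail Q).
Proof. exact: (@GL0_morph _ _ _ tail (block_banach1) tailM tail_continuous). Qed.

Lemma invertible_tail Q : invertible (tail Q) -> invertible Q.
Proof.
move=> [N [QN NQ]]; have [p [r [s [P NE]]]] := block_banachE N.
exists P; move: QN NQ; rewrite NE /tail !block_banachM -block_banach1.
rewrite !mul0mx !mulmx0 !add0r.
by move=> /block_banach_inj[_ _ _ QP] /block_banach_inj[_ _ _ PQ].
Qed.

(** As [x - 1] has square zero, [1 + t *: (x - 1)] has inverse
    [1 - t *: (x - 1)]. *)
Lemma GL0_unipotent (B : banachAlgType R[i]) (x : B) :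
  (x - 1) * (x - 1) = 0 -> GL0 x.
Proof.
move=> x0; apply: GL0_segment => t _; exists (1 - t%:C%C *: (x - 1)).
have E : (t%:C%C *: (x - 1)) * (t%:C%C *: (x - 1)) = 0.
  by rewrite -scalerAl -scalerAr x0 !scaler0.
split; first by rewrite mulrDl mul1r mulrBr mulr1 E subr0 subrK.
by rewrite mulrDr mulr1 mulrBl mul1r E subr0 subrK.
Qed.

Lemma GL0_upper r : GL0 (upper r).
Proof.
apply: GL0_unipotent; rewrite -block_banach1 block_banachB block_banachM.
rewrite !subrr !subr0 !(raddf0 (@scalar_mx A 1)) !mul0mx !mulmx0 !mul0r mxE !addr0.
exact: block_banach0.
Qed.

Lemma GL0_lower s : GL0 (lower s).
Proof.
apply: GL0_unipotent; rewrite -block_banach1 block_banachB block_banachM.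
rewrite !subrr !subr0 !(raddf0 (@scalar_mx A 1)) !mul0mx !mulmx0 !mul0r mxE !addr0.
exact: block_banach0.
Qed.

(** The Schur complement of a pivot with inverse [q]. *)
Definition schur q (r : 'M[A]_(1, n.+1)) (s : 'M[A]_(n.+1, 1))
    (Q : mx_banach A n) : mx_banach A n :=
  (Q : 'M[A]__) - s *m q%:M *m r.

Lemma schur_factorization p q r s Q : p * q = 1 -> q * p = 1 ->
  block_banach p r s Q = lower (s *m q%:M) * (corner p * tail (schur q r s Q))
    * upper (q%:M *m r).
Proof.
move=> pq qp; rewrite /lower /corner /tail /upper !block_banachM.
rewrite !(mul0mx, mulmx0, mul1mx, mulmx1, mul1r, mulr1, addr0, add0r).
have E0 : (0 : 'M[A]_1) 0 0 = 0 by rewrite mxE.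
rewrite E0 !addr0.
have E1 : (p%:M : 'M[A]_1) *m (q%:M *m r) = r.
  by rewrite mulmxA -scalar_mxM pq mul1mx.
have E2 : s *m q%:M *m (p%:M : 'M[A]_1) = s.
  by rewrite -mulmxA -scalar_mxM qp mulmx1.
by rewrite E1 E2 /schur addrC mulmxA subrK.
Qed.

(** The correction [s *m q%:M *m r] has two small factors, while [q] stays
    bounded: [q = 1 - (p - 1) * q] gives [`|q| <= 2 * `|1|] once
    [`|p - 1| <= 1 / 2]. *)
Lemma schur_near1 (e : R[i]) : 0 < e -> exists2 d : R[i], 0 < d &
  forall p q r s Q, p * q = 1 -> `|block_banach p r s Q - 1| < d ->
    `|schur q r s Q - 1| < e.
Proof.
move=> e0; pose c : R[i] := 1 + 2 * `|1 : A|.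
have c0 : 0 < c by rewrite addr_gt0// mulr_gt0// normr_gt0 oner_neq0.
have h0 : 0 < 2^-1 :> R[i] by rewrite invr_gt0.
have [d d0 [d2 de]] := pos_lower_bound h0 (divr_gt0 e0 c0).
exists d => // p q r s Q pq; rewrite -block_banach1 block_banachB.
rewrite norm_block_banach !subr0 => bd.
have q2 : `|q| <= 2 * `|1 : A|.
  have qE : q = 1 - (p - 1) * q by rewrite mulrBl pq mul1r opprB addrC subrK.
  suff : `|q| <= `|1 : A| + 2^-1 * `|q|.
    by rewrite -lerBlDr -{1}[`|q|]mul1r -mulrBl {1}[1]splitr mul1r addrK
      mulrC ler_pdivrMr// mulrC.
  rewrite {1}qE (le_trans (ler_normB _ _))// lerD//.
  rewrite (le_trans (normrM_le _ _))// ler_wpM2r//.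
  apply: le_trans d2; apply: le_trans (ltW bd).
  by rewrite -!addrA lerDl !addr_ge0 ?mx_norm1_ge0.
have srQ : schur q r s Q - 1 = (Q - 1) - (s *m q%:M *m r : 'M[A]__).
  by rewrite /schur addrAC.
rewrite srQ (le_lt_trans (ler_normB _ _))//.
set N := _ + _ in bd.
have QN : `|Q - 1| <= N by rewrite /N addrA lerDr !addr_ge0 ?mx_norm1_ge0.
have rN : mx_norm1 r <= N by rewrite /N [X in X + _]addrC -addrA lerDl !addr_ge0 ?mx_norm1_ge0.
have sN : mx_norm1 s <= N by rewrite /N addrCA lerDl !addr_ge0 ?mx_norm1_ge0.
have N1 : N <= 1 by rewrite (le_trans (ltW bd))// (le_trans d2)// invf_le1// ler1n.
apply: (@le_lt_trans _ _ (N * c)); last first.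
  by rewrite -ltr_pdivlMr// (lt_le_trans bd).
rewrite /c mulrDr mulr1 lerD//.
rewrite normed_mxE (le_trans (mx_norm1M _ _))// -[leRHS]mulr1 ler_pM ?mx_norm1_ge0//.
  rewrite (le_trans (mx_norm1M _ _))// ler_pM ?mx_norm1_ge0//.
  by rewrite mx_norm1_scalar.
exact: le_trans N1.
Qed.

End Blocks.

(** * Subspaces that reflect invertibility *)

Section Near.

Lemma near_dist_lt (K : numFieldType) (T : topologicalType) (V : normedModType K)
    (f : T -> V) (x : T) (v : V) (e : K) : f @ x --> f x -> `|f x - v| < e ->
  \forall y \near x, `|f y - v| < e.
Proof.
move=> + xe => /cvgrPdist_lt /(_ (e - `|f x - v|)); rewrite subr_gt0 => /(_ xe).
apply: filterS => y; rewrite ltrBrDr; apply: le_lt_trans.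
by rewrite [X in _ <= X + _]distrC ler_distD.
Qed.

Lemma dense_near (T : topologicalType) (S P : set T) (x : T) :
  dense S -> nbhs x P -> exists2 y, S y & P y.
Proof.
move=> Sd; rewrite nbhsE => -[U [oU Ux] UP].
have [|y [Uy Sy]] := Sd U _ oU; first by exists x.
by exists y => //; exact: UP.
Qed.

End Near.

Section SpectralSubspace.
Variables (R : realType) (A B : banachAlgType R[i]) (phi : {lrmorphism A -> B}).
Hypothesis phi_continuous : continuous phi.

(** Linear combinations act pointwise on loops and produce the segments in [GL0];
    the unit, which the subalgebra of relative spectrality may lack, is one end of
    these segments. *)
Record spectral_subspace (Y : set A) := SpectralSubspace {
  spectral1 : Y 1;
  spectralP : forall (k : R[i]) x y, Y x -> Y y -> Y (k *: x + y);
  spectral_dense : dense Y;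
  spectral_invertible : forall y, Y y -> invertible (phi y) -> invertible y
}.

Variable Y : set A.
Hypotheses (phi_dense : dense (range phi)) (Yspec : spectral_subspace Y).

(** The segment from [1] to [y] stays in [Y] and its image stays in the unit ball
    around [1], so all its points are invertible. *)
Lemma spectral_GL0 y : Y y -> `|phi y - 1| < 1 -> GL0 y.
Proof.
move=> Yy y1; apply: GL0_segment => t /andP[t0 t1].
apply: (spectral_invertible Yspec).
  rewrite addrC; apply: (spectralP Yspec _ _ (spectral1 Yspec)).
  rewrite addrC -scaleN1r; exact: (spectralP Yspec _ (spectral1 Yspec)).
apply: invertible_near1; rewrite linearD linearZ linearB rmorph1 /=.
rewrite addrAC subrr add0r normrZ (le_lt_trans _ y1)// -[leRHS]mul1r.
by rewrite ler_wpM2r// ger0_norm ?lecR.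
Qed.

(** Moving [w] slightly into [Y] changes neither its membership in [GL0] nor the
    smallness of [phi w - 1]. *)
Lemma reflects_near1_phi : reflects_near1 phi.
Proof.
exists 1 => // w /near_GL0 wi w1.
have [y Yy [[_ yw] y1]] := dense_near (spectral_dense Yspec)
  (filterI wi (near_dist_lt (@phi_continuous w) w1)).
exact/yw/spectral_GL0.
Qed.

Lemma dense_phiY : dense (phi @` Y).
Proof.
move=> U U0 oU; have [b [+ [x _ xb]]] := phi_dense U0 oU; rewrite -xb => Ux.
have : \forall y \near x, U (phi y).
  exact: (@phi_continuous x U (open_nbhs_nbhs (conj oU Ux))).
move=> /(dense_near (spectral_dense Yspec))[y Yy Uy].
by exists (phi y); split => //; exists y.
Qed.

Lemma covers_near1_phi : covers_near1 phi.
Proof.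
exists 1 => // b b1 U bU.
have b1' : \forall c \near b, `|(c : B) - 1| < 1.
  by apply: (@near_dist_lt _ _ _ id) => //; exact: cvg_id.
have [_ [y Yy <-] [Uy y1]] := dense_near dense_phiY (filterI bU b1').
by exists (phi y); split => //; exists y => //; exact: spectral_GL0.
Qed.

End SpectralSubspace.

(** * Injectivity on [K1] *)

Section MatrixMaps.
Variables (R : realType) (A B : banachAlgType R[i]) (phi : {lrmorphism A -> B}).

Lemma mx_map_block n p r s (Q : mx_banach A n) :
  mx_map phi (block_banach p r s Q) =
  block_banach (phi p) (map_mx phi r) (map_mx phi s) (mx_map phi Q).
Proof.
rewrite /mx_map /block_banach -(map_scalar_mx phi).
exact: (@map_block_mx _ _ _ 1 n.+1 1 n.+1).
Qed.

Lemma mx_map_schur n q r s (Q : mx_banach A n) :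
  mx_map phi (schur q r s Q) =
  schur (phi q) (map_mx phi r) (map_mx phi s) (mx_map phi Q).
Proof. by rewrite /mx_map /schur map_mxB !map_mxM map_scalar_mx. Qed.

Lemma dense_map_mx m n (r : 'M[B]_(m, n)) (e : R[i]) :
  dense (range phi) -> 0 < e ->
  exists r' : 'M[A]_(m, n), mx_norm1 (map_mx phi r' - r) < e.
Proof.
move=> /dense_normP phi_dense e0.
have d0 : 0 < e / (m * n).+1%:R by rewrite divr_gt0.
have /choice[g gP] : forall ij : 'I_m * 'I_n, exists a : A,
    `|phi a - r ij.1 ij.2| < e / (m * n).+1%:R.
  by move=> ij; have [_ [a _ <-] ?] := phi_dense (r ij.1 ij.2) _ d0; exists a.
exists (\matrix_(i, j) g (i, j)).
apply: (@le_lt_trans _ _ (\sum_(i < m) \sum_(j < n) e / (m * n).+1%:R)).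
  by apply: ler_sum => i _; apply: ler_sum => j _; rewrite !mxE ltW// (gP (i, j)).
rewrite !sumr_const !card_ord -mulrnA -[_ *+ _]mulr_natr mulrAC.
by rewrite ltr_pdivrMr// ltr_pM2l// ltr_nat mulnC.
Qed.

End MatrixMaps.

Section ScalarBanach.
Variables (R : realType) (A : banachAlgType R[i]).

Definition scalar_banach (p : A) : mx_banach A 0 := p%:M.

Lemma scalar_banachE (w : mx_banach A 0) : exists p, w = scalar_banach p.
Proof. by exists ((w : 'M[A]_1) 0 0); rewrite /scalar_banach -mx11_scalar. Qed.

Lemma scalar_banachM : {morph scalar_banach : p q / p * q}.
Proof. by move=> p q; exact: scalar_mxM. Qed.

Lemma norm_scalar_banachB p q : `|scalar_banach p - scalar_banach q| = `|p - q|.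
Proof.
rewrite normed_mxE -[X in mx_norm1 X]/((p%:M - q%:M) : 'M[A]_1).
by rewrite -raddfB mx_norm1_scalar.
Qed.

Lemma scalar_banach_inj : injective scalar_banach.
Proof.
by move=> p q pq; apply/subr0_eq/normr0_eq0; rewrite -norm_scalar_banachB pq subrr normr0.
Qed.

Lemma scalar_banach_continuous : continuous scalar_banach.
Proof.
apply: (@lipschitz_continuous R[i] A (mx_banach A 0) _ 1) => // p q.
by rewrite mul1r norm_scalar_banachB.
Qed.

Lemma invertible_scalar_banach p : invertible (scalar_banach p) -> invertible p.
Proof.
move=> [w]; have [q ->] := scalar_banachE w; rewrite -!scalar_banachM.
by move=> [/scalar_banach_inj pq /scalar_banach_inj qp]; exists q.
Qed.

Lemma GL0_scalar_banach p : GL0 p -> GL0 (scalar_banach p).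
Proof.
exact: (@GL0_morph _ _ _ scalar_banach (erefl _) scalar_banachM
  scalar_banach_continuous).
Qed.

End ScalarBanach.

Lemma invertible_factor (T : nzRingType) (l c t u : T) :
  invertible l -> invertible c -> invertible u ->
  invertible (l * (c * t) * u) -> invertible t.
Proof.
move=> [l' [ll l'l]] [c' [cc c'c]] [u' [uu u'u]] lctu.
have -> : t = c' * l' * (l * (c * t) * u) * u'.
  by rewrite -!mulrA uu mulr1 (mulrA l') l'l mul1r mulrA c'c mul1r.
apply: invertibleM; last by exists u.
by apply: invertibleM => //; apply: invertibleM; [exists c|exists l].
Qed.

Lemma quotient_map_inj (G H : groupType) (N : normal_subgroup G)
    (M : normal_subgroup H) (f : {multiplicative G -> H})
    (fNM : forall x, N x -> M (f x)) :
  (forall x, M (f x) -> N x) -> injective (quotient_map fNM).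
Proof.
move=> MN a b; have [x ->] := quotient_proj_surj a.
have [y ->] := quotient_proj_surj b; rewrite !quotient_mapE.
move=> /quotient_projP Mxy; apply/quotient_projP; apply: MN.
by rewrite gmulfM group_morphV.
Qed.

Lemma direct_limit_map_inj (D E : direct_system)
    (f : forall n, {multiplicative D n -> E n}) (fC : ds_compatible f) :
  (forall n, injective (f n)) -> injective (direct_limit_map fC).
Proof.
move=> finj a b; have [n [x [y [_ [-> -> _]]]]] := ds_inj_surj3 a b b.
rewrite !direct_limit_mapE => /ds_inj_eq[k]; rewrite -!(ds_shift_map fC) => fxy.
by apply/ds_inj_eq; exists k; exact: (finj _ _ _ fxy).
Qed.

Section MatrixGL0.
Variables (R : realType) (A B : banachAlgType R[i]) (phi : {lrmorphism A -> B}).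
Hypothesis phi_continuous : continuous phi.
Variable Y : set A.
Hypotheses (phi_dense : dense (range phi)) (Yspec : spectral_subspace phi Y).

Lemma mx_map_scalar p : mx_map phi (scalar_banach p) = scalar_banach (phi p).
Proof. exact: map_scalar_mx. Qed.

(** Only the corner of [w] is moved into [Y]; the elimination then leaves a Schur
    complement over [A] to which the induction hypothesis applies, its
    invertibility being inherited from that of the matrix. *)
Lemma reflects_near1_mx n : reflects_near1 (@mx_map _ _ _ phi n).
Proof.
elim: n => [|n [e e0 IH]].
  have [e e0 H] := reflects_near1_phi phi_continuous Yspec.
  exists e => // w; have [p ->] := scalar_banachE w.
  move=> /invertible_scalar_banach pi.
  rewrite mx_map_scalar -[1 in X in X -> _]/(scalar_banach 1) norm_scalar_banachB.
  by move=> pe; apply: GL0_scalar_banach; exact: H.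
have [d d0 Hd] := schur_near1 B n e0.
have [c c0 [c1 cd]] := pos_lower_bound (ltr01 : 0 < 1 :> R[i]) d0.
exists c => // w; have [p [r [s [Q ->]]]] := block_banachE w => wi wc.
have cg := @block_banach_corner_continuous _ _ n r s Q p.
have cG := @mx_map_continuous _ _ _ _ phi_continuous n.+1.
have [p' Yp [[gi gw] gc]] := dense_near (spectral_dense Yspec)
  (cg _ (filterI (near_GL0 wi) (near_dist_lt (cG _) wc))).
apply: gw; have p1 : `|phi p' - 1| < 1.
  apply: lt_le_trans c1; apply: le_lt_trans gc.
  rewrite mx_map_block -block_banach1 block_banachB norm_block_banach.
  by rewrite -!addrA lerDl !addr_ge0 ?mx_norm1_ge0.
have p'0 := spectral_GL0 Yspec Yp p1; have [q [pq qp]] := GL0_invertible p'0.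
move: gi; rewrite (schur_factorization r s Q pq qp) => gi.
apply: GL0_M; last exact: GL0_upper.
apply: GL0_M; first exact: GL0_lower.
apply: GL0_M; first exact: GL0_corner.
apply/GL0_tail/IH.
  apply: invertible_tail; move: gi; apply: invertible_factor.
  - exact/GL0_invertible/GL0_lower.
  - exact/GL0_invertible/GL0_corner.
  - exact/GL0_invertible/GL0_upper.
rewrite mx_map_schur; apply: (Hd (phi p')); first by rewrite -rmorphM pq rmorph1.
by rewrite -mx_map_block; exact: lt_le_trans gc cd.
Qed.

Lemma closure_upper n (r : 'M[B]_(1, n.+1)) :
  closure (mx_map phi (n:=n.+1) @` @GL0 _ _) (upper r).
Proof.
apply/closure_normP => e e0; have [r' r'e] := dense_map_mx r phi_dense e0.
exists (mx_map phi (upper r')); first by exists (upper r') => //; exact: GL0_upper.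
rewrite mx_map_block rmorph1 mx_map1 map_mx0 block_banachB norm_block_banach.
by rewrite !subrr !normr0 mx_norm1_0 add0r !addr0.
Qed.

Lemma closure_lower n (s : 'M[B]_(n.+1, 1)) :
  closure (mx_map phi (n:=n.+1) @` @GL0 _ _) (lower s).
Proof.
apply/closure_normP => e e0; have [s' s'e] := dense_map_mx s phi_dense e0.
exists (mx_map phi (lower s')); first by exists (lower s') => //; exact: GL0_lower.
rewrite mx_map_block rmorph1 mx_map1 map_mx0 block_banachB norm_block_banach.
by rewrite !subrr !normr0 mx_norm1_0 !add0r !addr0.
Qed.

(** Each of the four factors of the elimination is a limit of images of elements
    of [GL0], and such limits are stable under products. *)
Lemma covers_near1_mx n : covers_near1 (@mx_map _ _ _ phi n).
Proof.
elim: n => [|n [e e0 IH]].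
  have [e e0 H] := covers_near1_phi phi_continuous phi_dense Yspec.
  exists e => // w; have [p ->] := scalar_banachE w.
  rewrite -[1 in X in X -> _]/(scalar_banach 1) norm_scalar_banachB => /H.
  apply: closure_continuous; first exact: scalar_banach_continuous.
  move=> _ [x x0 <-]; rewrite -mx_map_scalar; apply: subset_closure.
  by exists (scalar_banach x) => //; exact: GL0_scalar_banach.
have [e1 e10 H] := covers_near1_phi phi_continuous phi_dense Yspec.
have [d d0 Hd] := schur_near1 B n e0.
have [c1 c10 [c11 c1e]] := pos_lower_bound (ltr01 : 0 < 1 :> R[i]) e10.
have [c c0 [cc1 cd]] := pos_lower_bound c10 d0.
exists c => // w; have [p [r [s [Q ->]]]] := block_banachE w => wc.
have pc : `|p - 1| < c1.
  apply: lt_le_trans cc1; apply: le_lt_trans wc.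
  rewrite -block_banach1 block_banachB norm_block_banach.
  by rewrite -!addrA lerDl !addr_ge0 ?mx_norm1_ge0.
have [q [pq qp]] := invertible_near1 (lt_le_trans pc c11).
rewrite (schur_factorization r s Q pq qp).
have HM := closure_imageM (@mx_mapM _ _ _ phi n.+1).
apply: (HM); last exact: closure_upper.
apply: (HM); first exact: closure_lower.
apply: (HM).
- have := H _ (lt_le_trans pc c1e).
  apply: (closure_continuous (@corner_continuous _ _ n)) => _ [x x0 <-].
  apply: subset_closure; exists (corner n x); first exact: GL0_corner.
  by rewrite mx_map_block mx_map1 !map_mx0.
- have := IH _ (Hd p q r s Q pq (lt_le_trans wc cd)).
  apply: (closure_continuous (@tail_continuous _ _ n)) => _ [x x0 <-].
  apply: subset_closure; exists (tail x); first exact: GL0_tail.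
  by rewrite mx_map_block rmorph1 !map_mx0.
Qed.

Lemma K1_map_inj : injective (K1_map phi_continuous).
Proof.
apply: direct_limit_map_inj => n; apply: quotient_map_inj.
apply: (@reflects_GL0 R (mx_banach A n) (mx_banach B n) (@mx_map _ _ _ phi n)).
- exact: mx_map1.
- exact: mx_mapM.
- exact: reflects_near1_mx.
- exact: covers_near1_mx.
Qed.

End MatrixGL0.

(** * Spectral subspaces from relative spectrality *)

Section SpectralFromRelative.
Variables (R : realType) (A B : banachAlgType R[i]) (phi : {lrmorphism A -> B}).

(** The subalgebra need not contain [1], so the translates [l%:A - x] are taken;
    their invertibility is what the two spectra record. *)
Lemma relatively_spectral_subspace : relatively_spectral phi ->
  exists Y : set A, spectral_subspace phi Y.
Proof.
move=> [X [[[X0 XP] _] Xd Xs]].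
exists [set y | exists l : R[i], exists2 x, x \in X & y = l%:A - x]; split.
- by exists 1, 0 => //; rewrite subr0 scale1r.
- move=> k _ _ [l [x xX ->]] [m [y yX ->]]; exists (k * l + m), (k *: x + y).
    exact: XP.
  by rewrite scalerBr scalerDl scalerA opprD addrACA.
- apply/dense_normP => b e e0; have /dense_normP/(_ (- b) e e0) [x xX xb] := Xd.
  exists (0 - x); first by exists 0, x => //; rewrite scale0r.
  by rewrite sub0r -normrN opprD opprK.
- move=> _ [l [x xX ->]]; rewrite linearB linearZ rmorph1 /= => phix.
  have : ~ spectrum (phi x) l by move=> /(_ phix).
  by rewrite (Xs x xX) => /contrapT.
Qed.

End SpectralFromRelative.

(** * Approximation of loops *)

Section PartitionOfUnity.
Variables (K : numFieldType) (V : normedModType K) (X : topologicalType).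
Variables (T : choiceType) (D : set T) (g : T -> V).

Lemma finite_net (f : X -> V) (e : K) :
  compact (range f) -> dense (g @` D) -> 0 < e ->
  exists2 s : seq T, {in s, forall d, D d} &
    forall t, exists2 d, d \in s & `|f t - g d| < e.
Proof.
rewrite compact_cover => cf /dense_normP gd e0.
have [||s sD scov] := cf T D (fun d => ball (g d) e).
- by move=> d _; exact: ball_open.
- move=> _ [t _ <-]; have [_ [d Dd <-] de] := gd (f t) e e0.
  by exists d => //; rewrite -ball_normE.
exists (finmap.enum_fset s).
  by move=> d /sD; rewrite inE.
move=> t; have [d ds] := scov (f t) (ex_intro2 _ _ t I (erefl _)).
by rewrite -ball_normE /= distrC => fd; exists d.
Qed.

(** A partition of unity in the target: the weight of [g d] at [x] is
    proportional to the positive part of [e - `|f x - g d|].  It depends on [x]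
    only through [f x], so that it takes equal values at the two ends of a loop. *)
Lemma partition_approx (f : X -> V) (e : K) : continuous f ->
  compact (range f) -> dense (g @` D) -> 0 < e ->
  exists (s : seq T) (w : T -> X -> K), [/\ {in s, forall d, D d},
    forall d, continuous (w d),
    forall d x y, f x = f y -> w d x = w d y &
    forall x, `|f x - \sum_(d <- s) w d x *: g d| <= e].
Proof.
move=> cf fc gd e0; have [s sD snet] := finite_net fc gd e0.
pose u d x : K := e - `|f x - g d|.
(* Twice the positive part of [u d x], in a form that is visibly continuous. *)
pose h d x : K := u d x + `|u d x|.
pose H x := \sum_(d <- s) h d x.
have uR d x : u d x \is Num.real by rewrite realB ?normr_real ?gtr0_real.
have h_ge0 d x : 0 <= h d x.
  by rewrite -lerBlDl sub0r (real_ler_normr _ (uR d x)) lexx orbT.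
have H_gt0 x : 0 < H x.
  have [d ds fd] := snet x; apply: (@lt_le_trans _ _ (h d x)).
    by rewrite ltr_pwDl ?subr_gt0.
  rewrite /H (big_rem d)//= lerDl; exact: sumr_ge0.
have hC d : continuous (h d).
  have uC : continuous (u d).
    move=> x; apply: cvgB; first exact: cvg_cst.
    apply: cvg_norm; apply: cvgB; [exact: cf|exact: cvg_cst].
  by move=> x; apply: cvgD; [exact: uC|apply: cvg_norm; exact: uC].
have HC : continuous H.
  by apply: continuous_big => //; exact: add_continuous.
exists s, (fun d x => h d x / H x); split=> //.
- move=> d x; apply: cvgM; first exact: hC.
  by apply: cvgV; [rewrite gt_eqF|exact: HC].
- by move=> d x y fxy; rewrite /H /h /u fxy.
- move=> x; have -> : f x - \sum_(d <- s) (h d x / H x) *: g d =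
      \sum_(d <- s) (h d x / H x) *: (f x - g d).
    under [RHS]eq_bigr do rewrite scalerBr.
    by rewrite sumrB -scaler_suml -mulr_suml -/(H x) divff ?scale1r ?gt_eqF.
  apply: (le_trans (ler_norm_sum _ _ _)).
  apply: (@le_trans _ _ (\sum_(d <- s) h d x / H x * e)); last first.
    by rewrite -mulr_suml -mulr_suml -/(H x) divff ?mul1r ?gt_eqF.
  apply: ler_sum => d _; rewrite normrZ ger0_norm; last first.
    by rewrite divr_ge0// ltW.
  have [ud|ud] := real_leP (@real0 K) (uR d x).
    by rewrite ler_wpM2l ?divr_ge0 ?(ltW (H_gt0 x))// -subr_ge0.
  by rewrite /h (ltr0_norm ud) subrr !mul0r.
Qed.

Lemma continuous_scaleB (w : X -> K) (k : K) (a : V) :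
  continuous w -> continuous (fun x => (w x - k) *: a).
Proof.
by move=> cw x; apply: cvgZr_tmp; apply: cvgB; [exact: cw|exact: cvg_cst].
Qed.

End PartitionOfUnity.

Section SuspensionApprox.
Variables (R : realType) (A : banachAlgType R[i]).
Local Notation C := R[i].
Local Notation I01 := (unit_interval R).

(** Extending [f] by a default value outside the interval moves the question to
    the compact segment of [R]. *)
Lemma compact_range (f : I01 -> A) : continuous f -> compact (range f).
Proof.
move=> cf; have -> : range f = valL f @` `[0%R, 1%R].
  apply/seteqP; split=> [_ [t _ <-]|_ [x x01 <-]].
    exists (sval t); first by have := svalP t; rewrite inE.
    by rewrite -[in RHS](valLK point f).
  exists (exist _ x (mem_set x01)) => //.
  by rewrite -[in LHS](valLK point f).
apply: continuous_compact; last exact: segment_compact.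
exact/subspace_valL_continuousP.
Qed.

(** Subtracting from each weight its value at the base point makes the
    approximation equal to the scalar [c] at both ends; this doubles the error.
    Continuity is stated for coefficients in any normed space since the same
    weights are used over [A] and over [B]. *)
Lemma susp_approx (T : choiceType) (D : set T) (g : T -> A) (f : suspension A)
    (e : C) : dense (g @` D) -> 0 < e ->
  exists (s : seq T) (c : C) (w : T -> I01 -> C), [/\ {in s, forall d, D d},
    forall (W : normedModType C) d (a : W), continuous (fun t => w d t *: a),
    forall d, w d (I0 R) = 0 /\ w d (I1 R) = 0 &
    forall t, `|susp_fun f t - (c%:A + \sum_(d <- s) w d t *: g d)| <= e].
Proof.
move=> gd e0; have h0 : 0 < e / 2 by rewrite divr_gt0.
have cf := @susp_continuous R A f.
have [s [w [sD wC wf fw]]] := partition_approx cf (compact_range cf) gd h0.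
have [c [f0 f1]] := susp_scalar f.
have w01 d : w d (I1 R) = w d (I0 R) by apply: wf; rewrite f0 f1.
exists s, c, (fun d t => w d t - w d (I0 R)); split=> //.
- by move=> W d a; apply: continuous_scaleB; exact: wC.
- by move=> d; rewrite w01 subrr.
- move=> t; have -> : susp_fun f t - (c%:A +
      \sum_(d <- s) (w d t - w d (I0 R)) *: g d) =
      (susp_fun f t - \sum_(d <- s) w d t *: g d)
      - (susp_fun f (I0 R) - \sum_(d <- s) w d (I0 R) *: g d).
    under eq_bigr do rewrite scalerBl.
    by rewrite sumrB f0 !opprD !opprK !addrA; congr (_ + _); rewrite addrAC.
  by rewrite [leRHS]splitr (le_trans (ler_normB _ _))// lerD.
Qed.

End SuspensionApprox.

(** * Injectivity on [K0] *)

Section SuspensionSpectral.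
Variables (R : realType).
Local Notation C := R[i].
Local Notation I01 := (unit_interval R).

(** From [g x - g y = g y * (f y - f x) * g x] one gets [`|g y| <= 2 * `|g x|] for
    [y] close to [x], and then convergence. *)
Lemma inverse_continuous (K : numFieldType) (A : banachAlgType K)
    (X : topologicalType) (f g : X -> A) : continuous f ->
  (forall x, f x * g x = 1) -> (forall x, g x * f x = 1) -> continuous g.
Proof.
move=> cf fg gf x; apply/cvgrPdist_le => e e0.
have n0 : 0 < `|g x| by rewrite normr_gt0; apply/eqP => g0;
  have := gf x; rewrite g0 mul0r => /eqP; rewrite eq_sym oner_eq0.
have h0 : 0 < 2^-1 :> K by rewrite invr_gt0.
have [d d0 [d2 de]] := pos_lower_bound (divr_gt0 h0 n0)
  (divr_gt0 (divr_gt0 e0 n0) (mulr_gt0 (ltr0Sn K 1) n0)).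
have := @cf x; move=> /cvgrPdist_lt /(_ d d0); apply: filterS => y fxy.
have E : g x - g y = g y * (f y - f x) * g x.
  by rewrite mulrBr gf mulrBl mul1r -mulrA fg mulr1.
have nE : `|g x - g y| <= `|g y| * (d * `|g x|).
  rewrite E (le_trans (normrM_le _ _))// mulrA ler_wpM2r//.
  by rewrite (le_trans (normrM_le _ _))// ler_wpM2l// distrC ltW.
have g2 : `|g y| <= 2 * `|g x|.
  have : `|g y| <= `|g x| + `|g y| * 2^-1.
    rewrite -lerBlDl (le_trans (lerB_dist _ _))// distrC (le_trans nE)//.
    by rewrite ler_wpM2l// -ler_pdivlMr.
  rewrite -lerBlDr -{1}[`|g y|]mulr1 -mulrBr {1}[1]splitr mul1r addrK.
  by rewrite ler_pdivrMr// mulrC.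
apply: (le_trans nE); apply: (@le_trans _ _ (2 * `|g x| * (d * `|g x|))).
  by rewrite ler_wpM2r// mulr_ge0// ltW.
rewrite mulrA -ler_pdivlMr// mulrC -ler_pdivlMr// mulr_gt0//.
Qed.

Section Invertible.
Variable A : banachAlgType C.

(** The pointwise inverse is continuous, and scalar where [f] is. *)
Lemma suspension_invertible (f : suspension A) :
  (forall t, invertible (susp_fun f t)) -> invertible f.
Proof.
move=> /choice[g gP]; have [c [f0 f1]] := susp_scalar f.
have c0 : c != 0.
  apply/eqP => c0; have [+ _] := gP (I0 R).
  by rewrite f0 c0 scale0r mul0r => /eqP; rewrite eq_sym oner_eq0.
have gc : continuous g.
  apply: (inverse_continuous (@susp_continuous R A f)) => t.
    by have [] := gP t.
  by have [] := gP t.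
have gE t : susp_fun f t = c%:A -> g t = c^-1%:A.
  move=> ft; have [_] := gP t; rewrite ft -scalerAr mulr1 => cg.
  by rewrite -cg scalerA mulVf// scale1r.
have g01 : exists k : C, g (I0 R) = k%:A /\ g (I1 R) = k%:A.
  by exists c^-1; split; exact: gE.
by exists (mksusp gc g01); split; apply: susp_eqP => t; have [] := gP t.
Qed.

End Invertible.

Variables (A B : banachAlgType C) (phi : {lrmorphism A -> B}).
Hypothesis phi_continuous : continuous phi.

Lemma susp_of_sum (D : banachAlgType C) (T : Type) (s : seq T) (c : C)
    (w : T -> I01 -> C) (g : T -> D) :
  (forall d (a : D), continuous (fun t => w d t *: a)) ->
  (forall d, w d (I0 R) = 0 /\ w d (I1 R) = 0) ->
  exists q : suspension D, forall t,
    susp_fun q t = c%:A + \sum_(d <- s) w d t *: g d.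
Proof.
move=> wC w01.
have qC : continuous (fun t => c%:A + \sum_(d <- s) w d t *: g d).
  move=> t; apply: (@cvgD C D _ (nbhs t)); first exact: cvg_cst.
  apply: (@continuous_big D T +%R 0 xpredT (@add_continuous D) _ s
    (fun d t => w d t *: g d)) => d _; exact: wC.
have q01 : exists k : C, c%:A + \sum_(d <- s) w d (I0 R) *: g d = k%:A /\
    c%:A + \sum_(d <- s) w d (I1 R) *: g d = k%:A.
  exists c; split; rewrite big1 ?addr0// => d _;
    by have [w0 w1] := w01 d; rewrite ?w0 ?w1 scale0r.
by exists (mksusp qC q01).
Qed.

(** The weights approximating a loop in [B] by vectors [phi a] are scalar
    functions, so they also define a loop in [A]. *)
Lemma susp_map_dense : dense (range phi) -> dense (range (susp_map phi_continuous)).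
Proof.
move=> phi_dense; apply/dense_normP => f e e0.
have e2 : 0 < e / 2 by rewrite divr_gt0.
have [s [c [w [_ wC w01 fw]]]] := susp_approx f phi_dense e2.
have [q qE] := susp_of_sum s c id (wC A) w01.
exists (susp_map phi_continuous q); first by exists q.
apply: (@le_lt_trans _ _ (e / 2)); last by rewrite ltr_pdivrMr// ltr_pMr// ltr1n.
apply: susp_norm_le => t; rewrite susp_funB distrC.
rewrite -[susp_fun (susp_map _ q) t]/(phi (susp_fun q t)) qE
  linearD linear_sum linearZ rmorph1 /=.
under eq_bigr do rewrite linearZ /=.
exact: fw.
Qed.

(** The approximating loops take their values in the span of [1] and of elements
    of [Y], which is [Y]. *)
Lemma susp_spectral_subspace (Y : set A) : spectral_subspace phi Y ->
  spectral_subspace (susp_map phi_continuous)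
    [set f : suspension A | forall t, Y (susp_fun f t)].
Proof.
move=> Yspec; have Y1 := spectral1 Yspec; have YP := spectralP Yspec.
have Y0 : Y 0 by have := YP (-1) 1 1 Y1 Y1; rewrite scaleN1r addNr.
split=> [t|k f g Yf Yg t||f Yf [g [fg gf]]].
- exact: Y1.
- exact: (YP k _ _ (Yf t) (Yg t)).
- apply/dense_normP => f e e0; have e2 : 0 < e / 2 by rewrite divr_gt0.
  have Yd : dense (id @` Y) by rewrite image_id; exact: spectral_dense Yspec.
  have [s [c [w [sY wC w01 fw]]]] := susp_approx f Yd e2.
  have [q qE] := susp_of_sum s c id (wC A) w01; exists q.
    move=> t; rewrite qE; apply: (YP) => //.
    elim: s sY {fw qE} => [|d s IH] sY; first by rewrite big_nil.
    rewrite big_cons; apply: (YP); first by apply: sY; rewrite mem_head.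
    by apply: IH => x xs; apply: sY; rewrite in_cons xs orbT.
  apply: (@le_lt_trans _ _ (e / 2)); last by rewrite ltr_pdivrMr// ltr_pMr// ltr1n.
  by apply: susp_norm_le => t; rewrite susp_funB distrC qE.
- apply: suspension_invertible => t; apply: (spectral_invertible Yspec) => //.
  exists (susp_fun g t); split.
    by have := congr1 (fun h => susp_fun h t) fg.
  by have := congr1 (fun h => susp_fun h t) gf.
Qed.

End SuspensionSpectral.

Theorem theorem1p1 (R : realType) (A B : banachAlgType R[i])
    (phi : {lrmorphism A -> B}) (phi_continuous : continuous phi) :
  dense (range phi) -> relatively_spectral phi ->
  injective (K0_map phi_continuous) /\ injective (K1_map phi_continuous).
Proof.
move=> phi_dense /relatively_spectral_subspace[Y Yspec]; split.
  apply: K1_map_inj; first exact: susp_map_dense.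
  exact: susp_spectral_subspace Yspec.
exact: K1_map_inj phi_dense Yspec.
Qed.
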